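(* Let $G$ be a graph of order $n$ with minimum degree $\delta(G)=d\ge 6$. Suppose that $a$, $y_0,\dots,y_{d+1}$, $b_0,\dots,b_{d+1}$ are nonnegative real numbers and $s$ is a positive real number such that all of the following inequalities hold: \begin{align*} (1)\;& s> a \ge y_{d+1} \ge y_d \ge \dots \ge y_0 \ge b_0 =0\\ (2)\;& 0 \le b_{d+1}-b_d \le b_d-b_{d-1} \le \dots \le b_2-b_1 \le b_1\\ (3)\;& 0\le y_{d+1}-b_{d+1} \le y_d-b_d \le \dots \le y_1-b_1 \le y_0\\ (4)\;& y_{d+1} \le a-\tfrac{s-a}{d+2}\\ (5)\;& y_d \le a-\tfrac{s-a}{d+1}\\ (6)\;& b_{d+1}\le a-\tfrac{s-a}{d+3}-\tfrac{s-a}{d+1}\\ (7)\;& b_d\le a-\tfrac{s-a}{d+2}-\tfrac{s-a}{d+1}\\ (8)\;& b_{d-1} \le a-2\cdot \tfrac{s-a}{d+1}\\ (9)\;& a+d(a-y_{d-1}) \ge s\\ (10)\;& a+d(y_{d+1}-b_d)\ge s\\ (11)\;& y_{d+1}+(d+1)(a-y_{d-2}) \ge s\\ (12)\;& y_{d+1}+(d+1)(y_{d+1}-b_d) \ge s\\ (13)\;& a+(d-1)(a-y_{d-2}) \ge s\\ (14)\;& a+(d-1)(y_d-b_{d-1})\ge s\\ (15)\;& y_d+d(a-y_{d-3}) \ge s\\ (16)\;& y_d+d(y_d-b_{d-1}) \ge s\\ (17)\;& b_{d+1}+(d+1)(a-y_{d-2})\ge s\\ (18)\;& b_{d+1}+(d+1)(y_{d-1}-b_{d-1})\ge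 s\\ (19)\;& a+(d-1)(b_3-b_2)+(y_2-b_1)+(d-3)(b_3-b_2)\ge s\\ (20)\;& y_2+(d-3)(b_3-b_2)+2(y_2-b_1+(d-3)(b_3-b_2))\ge s\\ (21)\;& a+0.5b_3+(d-1.5)(b_3-b_2)+(a-y_1)\ge s\\ (22)\;& a+0.5b_3+(d-1.5)(b_3-b_2)+(y_1-b_1+(d-3)(b_3-b_2))\ge s\\ (23)\;& 1.5a+ 0.5b_3 - 0.5y_0 + (d-2)(b_2-b_1) \ge s\\ (24)\;& a+ 0.5b_3 + 0.5y_1 - 0.5b_1 + (d-2)(b_2-b_1)+0.5(d-3)(b_3-b_2) \ge s\\ (25)\;& 1.5a +b_3+0.5(d-3)(b_3-b_1) + 0.5(d-2)(b_3-b_2) \ge s \\ (26)\;& a +b_3+ 0.5y_1-0.5b_1 +0.5(d-3)(b_3-b_1) + 0.5(d-4)(b_3-b_2) \ge s\\ (27)\;& b_3+3(a-y_0)\ge s\\ (28)\;& b_3+3(y_1-b_1+(d-3)(b_3-b_2))\ge s\\ (29)\;& 2y_1+2(d-2)(b_2-b_1)\ge s \\ (30)\;& a+0.5b_2+(d-1.5)(b_2-b_1)+0.5(a-y_1)\ge s\\ (31)\;& a+0.5b_2+(d-1.5)(b_2-b_1)+0.5(y_1-b_1+(d-3)(b_2-b_1))\ge s\\ (32)\;& a+0.5(d-1)b_2\ge s\\ (33)\;& b_2+2y_0+2(d-2)(b_2-b_1)\ge s\\ (34)\;& b_2+y_0+(d-2)(b_2-b_1)+(a-y_0)\ge s\\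 (35)\;& y_0+(d-1)b_1\ge s \end{align*} and, for every integer $i$ with $2\le i\le d-2$, \begin{align*} (36)\;& a+ (d-i)(b_{i+2}-b_{i+1}) +i(a-y_{i-1}) \ge s \\ (37)\;& a+(d-i)(b_{i+2}-b_{i+1})+ i(y_{i+1}-b_{i}+(d-i-2)(b_{i+2}-b_{i+1}))\ge s\\ (38)\;& y_{i+1}+(d-i-2)(b_{i+2}-b_{i+1})+ (i+1)(a-y_{i-2})\ge s\\ (39)\;& y_{i+1}+(d-i-2)(b_{i+2}-b_{i+1})+ (i+1)(y_{i+1}-b_{i}+(d-i-2)(b_{i+2}-b_{i+1}))\ge s\\ (40)\;& b_{i+2}+(i+2)(a-y_{i-1})\ge s\\ (41)\;& b_{i+2}+(i+2)(y_{i}-b_{i}+(d-i-2)(b_{i+2}-b_{i+1}))\ge s. \end{align*} Then $$\gamma_2(G) \le \frac{a}{s}\,n.$$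
   Context: All graphs are finite, simple and undirected; the order of a graph is its number of vertices. A set $D\subseteq V(G)$ is a $2$-dominating set of $G$ if every vertex of $V(G)\setminus D$ has at least two neighbors in $D$. The $2$-domination number $\gamma_2(G)$ is the minimum cardinality of a $2$-dominating set of $G$. *)

(* Defs.v *)
From mathcomp Require Import all_boot.

Set Implicit Arguments.
Unset Strict Implicit.
Unset Printing Implicit Defensive.

Section Graph.

(* A finite simple undirected graph is a finite vertex type T together with an
   adjacency relation e, which users assume symmetric and irreflexive. *)
Variables (T : finType) (e : rel T).

Definition neighbors (v : T) : {set T} := [set u | e v u].

Definition degree (v : T) : nat := #|neighbors v|.

(* All degrees are less than #|T|, so the initial value #|T| matters only for the
   empty graph, whose minimum degree is thus 0 by convention. *)
Definition min_degree : nat := \big[minn/#|T|]_(v : T) degree v.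

Definition two_dominating (D : {set T}) : bool :=
  [forall v in ~: D, 2 <= #|neighbors v :&: D|].

(* [set: T] is vacuously 2-dominating, so the minimum is over a nonempty
   family. *)
Definition gamma2 : nat := #|[arg min_(D < [set: T] | two_dominating D) #|D| ]|.

End Graph.

(* Main.v *)
Require Import Defs.
From mathcomp Require Import all_boot all_order all_algebra.
From mathcomp Require Import reals.
From mathcomp Require Import zify ring lra.

(** Weight every vertex outside the growing set D: a if it has no neighbour in D
    ("white"), y_i if it has exactly one ("yellow"), b_i if it has at least two
    ("blue"), where i is its number of white and yellow neighbours.  When no white
    or yellow vertex is left, D is 2-dominating and the weight is nonnegative.  So it
    is enough to enlarge D repeatedly by nonempty sets A lowering the total weight by
    at least s|A|.  If no such A exists, then adding one vertex at a time bounds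
    the degrees i by 1, 2 and 3 for white, yellow and blue vertices ((9)-(18) and
    (36)-(41)), and adding one vertex, a pair, or finally all white vertices shows
    that no white or yellow vertex remains ((19)-(35)).

    This argument starts once white vertices have i <= d and yellow ones i <= d+1.
    Before that, D is built greedily with other weights: a vertex adjacent to a
    vertex put into D at level N (white with i = N or yellow with i = N+1, all other
    levels being at most N) loses (s-a)/N.  Conditions (4)-(8) say that
    the weights y_i, b_i are at most the weights left at the end of this stage. *)

Set Implicit Arguments.
Unset Strict Implicit.
Unset Printing Implicit Defensive.

Import Order.TTheory GRing.Theory Num.Theory.
Local Open Scope ring_scope.

(** * Vertex classes, weights, and their behaviour when [D] grows *)

Section Potential.

Variables (R : realFieldType) (T : finType) (e : rel T).
Hypothesis e_sym : symmetric e.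
Variables (a : R) (Y B : nat -> R).
Hypothesis Y_le_a : forall k, Y k <= a.
Hypothesis Y_mono : {homo Y : i j / (i <= j)%N >-> i <= j}.
Hypothesis B_mono : {homo B : i j / (i <= j)%N >-> i <= j}.
Hypothesis B_le_Y : forall k, B k <= Y k.

Implicit Types (D A : {set T}) (u v z : T).
Local Notation N := (neighbors e).

Definition red D v := #|N v :&: D|.
Definition undom D := [set v | (v \notin D) && (red D v <= 1)%N].
Definition blue D := [set v | (v \notin D) && (1 < red D v)%N].
Definition white D v := (v \notin D) && (red D v == 0)%N.
Definition yellow D v := (v \notin D) && (red D v == 1)%N.
Definition wyd D v := #|N v :&: undom D|.
Definition bluedeg D v := #|N v :&: blue D|.

Definition wt D v : R :=
  if v \in D then 0 else
  match red D v with 0 => a | 1 => Y (wyd D v) | _ => B (wyd D v) end.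

Definition Phi D := \sum_v wt D v.

Lemma undomE D v : (v \in undom D) = white D v || yellow D v.
Proof. by rewrite inE /white /yellow; case: (v \notin D) (red D v) => [] [|[|?]]. Qed.

Lemma white_undom D v : white D v -> v \in undom D.
Proof. by rewrite undomE => ->. Qed.

Lemma yellow_undom D v : yellow D v -> v \in undom D.
Proof. by rewrite undomE => ->; rewrite orbT. Qed.

Lemma undom_notin D v : v \in undom D -> v \notin D.
Proof. by rewrite inE => /andP[]. Qed.

Lemma blue_notin D v : v \in blue D -> v \notin D.
Proof. by rewrite inE => /andP[]. Qed.

Lemma blue_undom D v : v \in blue D -> v \notin undom D.
Proof. by rewrite !inE => /andP[-> h]; rewrite -ltnNge. Qed.

Lemma wt_white D v : white D v -> wt D v = a.
Proof. by rewrite /wt => /andP[/negbTE-> /eqP->]. Qed.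

Lemma wt_yellow D v : yellow D v -> wt D v = Y (wyd D v).
Proof. by rewrite /wt => /andP[/negbTE-> /eqP->]. Qed.

Lemma wt_blue D v : v \in blue D -> wt D v = B (wyd D v).
Proof. by rewrite /wt inE => /andP[/negbTE->]; case: (red D v) => [|[|]]. Qed.

Lemma red_mono D D' v : D \subset D' -> (red D v <= red D' v)%N.
Proof. by move=> sD; rewrite subset_leq_card // setIS. Qed.

Lemma undom_mono D D' : D \subset D' -> undom D' \subset undom D.
Proof.
move=> sD; apply/subsetP => v; rewrite !inE => /andP[vD' h].
by rewrite (contra (subsetP sD v)) // (leq_trans (red_mono _ sD)).
Qed.

Lemma wyd_mono D D' v : D \subset D' -> (wyd D' v <= wyd D v)%N.
Proof. by move=> sD; rewrite subset_leq_card // setIS // undom_mono. Qed.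

(** A vertex leaves the undominated set either by joining [A] or by acquiring a second neighbour in
    the enlarged set; both kinds are meant here. *)
Definition lost D A := undom D :\: undom (D :|: A).

Lemma wyd_setU D A v : wyd (D :|: A) v = (wyd D v - #|N v :&: lost D A|)%N.
Proof.
have sU := undom_mono (subsetUl D A).
rewrite /wyd /lost setIDA cardsD subKn; last by rewrite subset_leq_card ?subsetIl.
by rewrite -setIA (setIidPr sU).
Qed.

Lemma lost_le D A v : (#|N v :&: lost D A| <= wyd D v)%N.
Proof. by rewrite subset_leq_card // setIS // subsetDl. Qed.

(** As [D] grows, [red] can only rise and [wyd] can only fall, so the weight moves down the chain
    [a], [Y], [B] and down within each of these sequences. *)
Lemma wt_mono D D' v : D \subset D' -> v \notin D' -> wt D' v <= wt D v.
Proof.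
move=> sD vD'; have vD := contra (subsetP sD v) vD'.
rewrite /wt (negbTE vD) (negbTE vD').
have := red_mono v sD; have := wyd_mono v sD => hw.
have hY := Y_mono hw; have hB := B_mono hw.
case: (red D v) => [|[|r]]; case: (red D' v) => [|[|r']] //= _.
  by apply: le_trans (B_le_Y _) (Y_le_a _).
exact: le_trans hB (B_le_Y _).
Qed.

(** * The drop of the total weight when a set is added *)

Definition bluedeg_out D A u := #|N u :&: (blue D :\: A)|.

(* Every vertex u leaving the undominated set charges c u to each of its blue
   neighbours; by the hypothesis on c, a blue vertex loses at least the weight it is
   charged. *)
Lemma gain D A (c X : T -> R) (S : seq T) :
  [disjoint A & D] -> (forall u, 0 <= c u) ->
  (forall z, z \in blue D -> z \notin A ->
    \sum_(u in N z :&: lost D A) c u <=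
    B (wyd D z) - B (wyd D z - #|N z :&: lost D A|)%N) ->
  uniq S -> {subset S <= undom D :\: A} ->
  (forall u, u \in S -> X u <= wt D u - wt (D :|: A) u
     + (if (1 < red (D :|: A) u)%N then c u * (bluedeg_out D A u)%:R else 0)) ->
  \sum_(v in A) wt D v
  + \sum_(v in A :&: undom D) c v * (bluedeg_out D A v)%:R
  + \sum_(u <- S) X u <= Phi D - Phi (D :|: A).
Proof.
move=> dAD c0 hc uS SU hX; set D' := D :|: A.
have sD : D \subset D' by apply: subsetUl.
pose g u := wt D u - wt D' u; pose h u := c u * (bluedeg_out D A u)%:R.
have g0 u : u \notin A -> 0 <= g u.
  move=> uA; rewrite /g; case uD: (u \in D); first by rewrite /wt !inE uD /= subr0.
  by rewrite subr_ge0 wt_mono // inE uD.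
have h0 u : 0 <= h u by rewrite mulr_ge0.
(* Double counting of the edges between lost vertices and blue vertices outside [A]: the total
   charge is regrouped by the blue end, where [hc] bounds it. *)
have hL : \sum_(u in lost D A) h u <= \sum_(z in blue D :\: A) g z.
  have -> : \sum_(u in lost D A) h u =
      \sum_(z in blue D :\: A) \sum_(u in N z :&: lost D A) c u.
    rewrite /h /bluedeg_out; under eq_bigr => u _ do rewrite -sum1_card natr_sum mulr_sumr.
    rewrite (exchange_big_dep (mem (blue D :\: A))) /=; last first.
      by move=> u z _; rewrite in_setI => /andP[].
    apply: eq_bigr => z zB; apply: eq_big => [u|u _]; rewrite ?mulr1 //.
    by rewrite 2!in_setI zB andbT andbC !in_set e_sym.
  apply: ler_sum => z /setDP[zB zA]; apply: le_trans (hc z zB zA) _.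
  have zB' : z \in blue D'.
    move: zB; rewrite !inE (negbTE zA) orbF => /andP[-> hz].
    by apply: leq_trans hz (red_mono _ sD).
  by rewrite /g !wt_blue // lerD2l lerN2 -wyd_setU.
(* Members of [A] end with weight 0, so each gives up its whole weight. *)
have hA : \sum_(v in A) wt D v = \sum_(v in A) g v.
  by apply: eq_bigr => v vA; rewrite /g /D' {3}/wt inE vA orbT subr0.
have hS : \sum_(u <- S) X u <=
    \sum_(u in undom D :\: A) (g u + if (1 < red D' u)%N then h u else 0).
  apply: le_trans (_ : \sum_(u <- S) (g u + if (1 < red D' u)%N then h u else 0) <= _).
    by rewrite !big_seq; apply: ler_sum.
  rewrite big_uniq //= [leRHS](bigID (mem S)) /=.
  rewrite [X in _ <= X + _](eq_bigl (mem S)) => [|u]; last first.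
    by rewrite andb_idl // => /SU.
  rewrite lerDl sumr_ge0 // => u /andP[/setDP[_ uA] _].
  by rewrite addr_ge0 ?g0 //; case: ifP.
(* Outside [A], a vertex of [undom D] is lost exactly when it now has two neighbours in the enlarged
   set; this is the origin of the conditional charge in the statement. *)
have hlost : \sum_(u in lost D A) h u = \sum_(v in A :&: undom D) h v
    + \sum_(u in undom D :\: A) if (1 < red D' u)%N then h u else 0.
  rewrite (bigID (mem A)) -big_mkcondr /=; congr (_ + _); apply: eq_bigl => u.
    rewrite /lost !in_set; case uA: (u \in A); last by rewrite !andbF.
    by rewrite orbT /= andbT.
  rewrite /lost !in_set; case uA: (u \in A); rewrite ?andbF //= andbT orbF.
  by rewrite ltnNge; case: (u \in D) => //=; rewrite andbC.
(* The three index sets are disjoint, and every remaining vertex contributes a nonnegative drop by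
   [g0]. *)
have hall : Phi D - Phi D' >= \sum_(v in A) g v + \sum_(u in undom D :\: A) g u
    + \sum_(z in blue D :\: A) g z.
  rewrite /Phi -sumrB -/(\sum_v g v).
  rewrite [leRHS](bigID (mem A)) -addrA lerD2l /= [leRHS](bigID (mem (undom D))) /=.
  apply: lerD; first by rewrite le_eqVlt; apply/orP; left; apply/eqP/eq_bigl => u;
    rewrite in_setD.
  rewrite [leRHS](bigID (mem (blue D))) /= -[leLHS]addr0; apply: lerD; last first.
    by apply: sumr_ge0 => u /andP[/andP[uA _] _]; exact: g0.
  rewrite le_eqVlt; apply/orP; left; apply/eqP/eq_bigl => u; rewrite in_setD.
  by case uB: (u \in blue D); rewrite ?andbF //= blue_undom ?andbT.
move: hS hL; rewrite big_split /= -/D' -/h hA hlost; lra.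
Qed.

(** * Irreducible sets, concavity of the blue weights, and the minimum degree *)

Hypothesis e_irr : irreflexive e.
Variables (d : nat) (s : R).
Hypothesis deg_ge : forall v, (d <= degree e v)%N.
Hypothesis B_concave : forall k, B k.+2 - B k.+1 <= B k.+1 - B k.
Hypothesis YB_mono : forall k, Y k.+1 - B k.+1 <= Y k - B k.

Definition irreducible D := forall A, A != set0 -> [disjoint A & D] ->
  Phi D - Phi (D :|: A) < #|A|%:R * s.

(** A uniform charge [t] that every blue vertex can afford to pay to each undominated neighbour it
    loses. *)
Definition slope D (t : R) := forall z m, z \in blue D -> (m <= wyd D z)%N ->
  t * m%:R <= B (wyd D z) - B (wyd D z - m)%N.

Lemma B_slope i k : (i <= k)%N -> B k.+1 - B k <= B i.+1 - B i.
Proof.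
by elim: k => [|k IH]; rewrite leq_eqVlt => /predU1P[->//|//] /IH; exact: le_trans.
Qed.

Lemma YB_le i k : (i <= k)%N -> Y k - B k <= Y i - B i.
Proof.
by elim: k => [|k IH]; rewrite leq_eqVlt => /predU1P[->//|//] /IH; exact: le_trans.
Qed.

Lemma slope0 D : slope D 0.
Proof. by move=> z m _ _; rewrite mul0r subr_ge0 B_mono // leq_subr. Qed.

(** By concavity the increments of [B] shrink, so each of the [m] increments removed is at least the
    one from [k] to [k.+1]. *)
Lemma B_drop n m k : (n <= k.+1)%N -> (m <= n)%N ->
  (B k.+1 - B k) * m%:R <= B n - B (n - m)%N.
Proof.
move=> hn; elim: m => [|m IH] hm; first by rewrite mulr0 subn0 subrr.
have h2 : B k.+1 - B k <= B (n - m)%N - B (n - m.+1)%N.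
  have -> : (n - m = (n - m.+1).+1)%N by rewrite subnSK.
  by apply: B_slope; move: hn hm; clear; lia.
by have := IH (ltnW hm); rewrite -natr1; lra.
Qed.

Lemma slope_top D k : (forall z, z \in blue D -> (wyd D z <= k.+1)%N) ->
  slope D (B k.+1 - B k).
Proof. by move=> hk z m zB; exact: B_drop (hk z zB). Qed.

Lemma nbr_split D v : degree e v = (red D v + wyd D v + bluedeg D v)%N.
Proof.
rewrite /degree /red /wyd /bluedeg -[N v in LHS](setIT) -(setUCr D) setIUr.
rewrite cardsU setIACA setICr setI0 cards0 subn0.
rewrite -addnA; congr addn.
have -> : ~: D = undom D :|: blue D.
  by apply/setP => x; rewrite !inE; case: (x \in D) => //=; rewrite ltnNge orbN.
rewrite setIUr cardsU -setIIr.
have -> : undom D :&: blue D = set0.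
  apply/setP => x; rewrite in_setI in_set0; apply/negbTE/negP => /andP[h1 /blue_undom].
  by rewrite h1.
by rewrite setI0 cards0 subn0.
Qed.

(** A white vertex has no neighbour in [D], so all but its undominated neighbours are blue. For a
    yellow vertex, treated next, one further neighbour is spent on [D]. *)
Lemma white_blue D v : white D v -> d%:R - (wyd D v)%:R <= (bluedeg D v)%:R :> R.
Proof.
case/andP => _ /eqP r0; have := deg_ge v; rewrite (nbr_split D) r0 add0n.
by rewrite -(ler_nat R) natrD; lra.
Qed.

Lemma yellow_blue D v : yellow D v ->
  d%:R - 1 - (wyd D v)%:R <= (bluedeg D v)%:R :> R.
Proof.
case/andP => _ /eqP r0; have := deg_ge v; rewrite (nbr_split D) r0.
by rewrite -(ler_nat R) !natrD; lra.
Qed.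

Lemma red_setU D A u : [disjoint A & D] ->
  red (D :|: A) u = (red D u + #|N u :&: A|)%N.
Proof.
move=> dAD; rewrite /red setIUr cardsU setIACA setIid.
have -> : D :&: A = set0 by rewrite setIC; apply/eqP; rewrite setI_eq0.
by rewrite setI0 cards0 subn0.
Qed.

(** Covers yellow and blue vertices at once, through [B_le_Y]; thus a white vertex that receives a
    neighbour need not be followed further. *)
Lemma wt_undom_le D u k : u \notin D -> (0 < red D u)%N -> (wyd D u <= k)%N ->
  wt D u <= Y k.
Proof.
move=> uD r0 wk; rewrite /wt (negbTE uD).
case: (red D u) r0 => [|[|r]] // _; first exact: Y_mono.
exact: le_trans (B_mono wk) (B_le_Y _).
Qed.

Lemma wt_blue_le D u k : u \notin D -> (1 < red D u)%N -> (wyd D u <= k)%N ->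
  wt D u <= B k.
Proof.
move=> uD r0 wk; rewrite /wt (negbTE uD).
by case: (red D u) r0 => [|[|r]] // _; exact: B_mono.
Qed.

Lemma red_gt0 D A u x : [disjoint A & D] -> x \in A -> e u x ->
  (red D u < red (D :|: A) u)%N.
Proof.
move=> dAD xA eux; rewrite red_setU // -addn1 leq_add2l card_gt0.
by apply/set0Pn; exists x; rewrite inE xA inE eux.
Qed.

Lemma red_gt1 D A u x x' : [disjoint A & D] -> x \in A -> x' \in A -> x != x' ->
  e u x -> e u x' -> (red D u + 2 <= red (D :|: A) u)%N.
Proof.
move=> dAD xA xA' xx' eux eux'; rewrite red_setU // leq_add2l.
have <- : #|[set x; x']| = 2%N by rewrite cards2 xx'.
apply: subset_leq_card; apply/subsetP => t; rewrite !inE.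
by case/orP => /eqP->; rewrite ?eux ?eux'.
Qed.

(** * The gain from adding one vertex *)

Lemma slope_charge D A t z : slope D t -> z \in blue D ->
  \sum_(u in N z :&: lost D A) t
  <= B (wyd D z) - B (wyd D z - #|N z :&: lost D A|)%N.
Proof. by move=> ht zB; rewrite sumr_const -mulr_natr ht // lost_le. Qed.

Lemma wyd_pred D A v x : x \in undom D -> x \in A -> e v x ->
  (wyd (D :|: A) v <= (wyd D v).-1)%N.
Proof.
move=> xU xA evx; rewrite wyd_setU -subn1 leq_sub2l // card_gt0.
apply/set0Pn; exists x; rewrite in_setI in_setD xU andbT [x \in N v]inE evx /=.
by rewrite inE inE xA orbT.
Qed.

(** White neighbours of [v] become yellow, yellow ones become blue and so charge their blue
    neighbours. The booleans act as 0 or 1: an undominated [v] disappears from the [wyd] of its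
    neighbours, while a blue [v] disappears from their blue neighbours and can no longer be
    charged. *)
Lemma gain1 D v (t : R) (X : T -> R) : v \notin D -> slope D t -> 0 <= t ->
  (forall u, e v u -> white D u -> X u <= a - Y (wyd D u - (v \in undom D))%N) ->
  (forall u, e v u -> yellow D u -> X u <= Y (wyd D u) -
     B (wyd D u - (v \in undom D))%N + t * ((bluedeg D u)%:R - (v \in blue D)%:R)) ->
  wt D v + (if v \in undom D then t * (bluedeg D v)%:R else 0)
  + \sum_(u in N v :&: undom D) X u <= Phi D - Phi (D :|: [set v]).
Proof.
move=> vD ht t0 hW hY.
have dAD : [disjoint [set v] & D] by rewrite disjoints1.
have vv : v \in [set v] by rewrite inE.
have nv u : e v u -> u != v by move=> evu; apply: contraTneq evu => ->; rewrite e_irr.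
apply: le_trans (@gain D [set v] (fun=> t) X (enum (N v :&: undom D))
  dAD _ _ (enum_uniq _) _ _) => //; last first.
- move=> u; rewrite mem_enum in_setI inE => /andP[evu uU].
  have evu' : e u v by rewrite e_sym.
  have wydu : (wyd (D :|: [set v]) u <= wyd D u - (v \in undom D))%N.
    case vU: (v \in undom D); last by rewrite subn0 wyd_mono // subsetUl.
    by rewrite subn1 (wyd_pred vU vv).
  have red1 := red_gt0 dAD vv evu'.
  have uD' : u \notin D :|: [set v] by rewrite in_setU in_set1 negb_or undom_notin ?nv.
  move: uU; rewrite undomE => /orP[uw|uy].
    apply: le_trans (hW u evu uw) _; rewrite (wt_white uw) -addrA lerD2l.
    rewrite -[leLHS]addr0 lerD ?lerN2 ?wt_undom_le //; first exact: leq_ltn_trans red1.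
    by case: ifP => // _; rewrite mulr_ge0.
  have red2 : (1 < red (D :|: [set v]) u)%N by case/andP: uy red1 => _ /eqP->.
  apply: le_trans (hY u evu uy) _; rewrite (wt_yellow uy) red2.
  rewrite lerD ?lerD2l ?lerN2 ?wt_blue_le // ler_wpM2l // /bluedeg_out setIDA.
  by rewrite /bluedeg (cardsD1 v (N u :&: blue D)) in_setI inE evu' natrD; lra.
- by move=> u; rewrite mem_enum !inE => /andP[evu ->]; rewrite nv.
- by move=> z zB _; apply: slope_charge.
rewrite big_set1 big_enum lerD2r lerD2l; case: ifP => vU; last first.
  by rewrite sumr_ge0 // => u _; rewrite mulr_ge0.
have -> : [set v] :&: undom D = [set v] by apply/setIidPl; rewrite sub1set.
rewrite big_set1 ler_wpM2l // ler_nat subset_leq_card // subsetI subsetIl subsetD.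
by rewrite subsetIr disjoint_sym disjoints1 !inE e_irr.
Qed.

Lemma irreducible1 D v : irreducible D -> v \notin D ->
  Phi D - Phi (D :|: [set v]) < s.
Proof.
move=> iD vD; have := iD [set v]; rewrite cards1 mul1r; apply.
  by apply/set0Pn; exists v; rewrite inE.
by rewrite disjoints1.
Qed.

Lemma irreducible_undom D v t x : irreducible D -> v \in undom D -> slope D t -> 0 <= t ->
  (forall u, e v u -> white D u -> x <= a - Y (wyd D u).-1) ->
  (forall u, e v u -> yellow D u ->
     x <= Y (wyd D u) - B (wyd D u).-1 + t * (bluedeg D u)%:R) ->
  wt D v + t * (bluedeg D v)%:R + (wyd D v)%:R * x < s.
Proof.
move=> iD vU ht t0 hW hY; have vD := undom_notin vU.
apply: le_lt_trans (irreducible1 iD vD).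
have vB : v \in blue D = false by apply: contraTF vU; exact: blue_undom.
apply: le_trans (@gain1 D v t (fun=> x) vD ht t0 _ _); rewrite ?vU ?vB ?subr0.
- by rewrite lerD2l sumr_const mulr_natl.
- by move=> u evu uW; rewrite subn1 hW.
- by move=> u evu uY; rewrite subn1 subr0 hY.
Qed.

Lemma irreducible_blue D v t X : irreducible D -> v \in blue D -> slope D t -> 0 <= t ->
  (forall u, e v u -> white D u -> X u <= a - Y (wyd D u)) ->
  (forall u, e v u -> yellow D u ->
     X u <= Y (wyd D u) - B (wyd D u) + t * ((bluedeg D u)%:R - 1)) ->
  B (wyd D v) + \sum_(u in N v :&: undom D) X u < s.
Proof.
move=> iD vB ht t0 hW hY; have vD := blue_notin vB.
apply: le_lt_trans (irreducible1 iD vD).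
have vU := negbTE (blue_undom vB).
apply: le_trans (@gain1 D v t X vD ht t0 _ _); rewrite ?vU ?vB.
- by rewrite addr0 wt_blue.
- by move=> u evu uW; rewrite subn0 hW.
- by move=> u evu uY; rewrite subn0 hY.
Qed.

Lemma irreducible_blue_unif D v t x : irreducible D -> v \in blue D -> slope D t -> 0 <= t ->
  (forall u, e v u -> white D u -> x <= a - Y (wyd D u)) ->
  (forall u, e v u -> yellow D u ->
     x <= Y (wyd D u) - B (wyd D u) + t * ((bluedeg D u)%:R - 1)) ->
  B (wyd D v) + (wyd D v)%:R * x < s.
Proof.
move=> iD vB ht t0 hW hY; have := irreducible_blue iD vB ht t0 hW hY.
by rewrite sumr_const mulr_natl.
Qed.

Lemma wyd_gt0 D u v : v \in undom D -> e u v -> (0 < wyd D u)%N.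
Proof.
by move=> vU euv; rewrite card_gt0; apply/set0Pn; exists v; rewrite in_setI inE euv.
Qed.

(** The gain is smallest at the largest degree: [Y k.+1 - B k] is [Y k.+1 - B k.+1] plus
    [B k.+1 - B k], both nonincreasing in [k], and more undominated neighbours leave fewer
    guaranteed blue ones to charge. *)
Lemma yellow_gain_undom D u j t : yellow D u -> (0 < wyd D u <= j.+1)%N -> 0 <= t ->
  Y j.+1 - B j + t * (d%:R - 1 - j.+1%:R)
  <= Y (wyd D u) - B (wyd D u).-1 + t * (bluedeg D u)%:R.
Proof.
move=> uY; have := yellow_blue uY; case: (wyd D u) => [|k] //= hb hk t0.
have h1 := YB_le hk; have h2 := @B_slope k j hk.
have h3 : k.+1%:R <= j.+1%:R :> R by rewrite ler_nat.
have h4 : t * (d%:R - 1 - j.+1%:R) <= t * (bluedeg D u)%:R.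
  by rewrite ler_wpM2l //; lra.
lra.
Qed.

(** The added vertex is itself a blue neighbour of [u] here, which accounts for 2 in place of 1 next
    to [d]. *)
Lemma yellow_gain_blue D u j t : yellow D u -> (wyd D u <= j)%N -> 0 <= t ->
  Y j - B j + t * (d%:R - 2 - j%:R)
  <= Y (wyd D u) - B (wyd D u) + t * ((bluedeg D u)%:R - 1).
Proof.
move=> uY hk t0; have hb := yellow_blue uY; have h1 := YB_le hk.
have h3 : (wyd D u)%:R <= j%:R :> R by rewrite ler_nat.
have h4 : t * (d%:R - 2 - j%:R) <= t * ((bluedeg D u)%:R - 1).
  by rewrite ler_wpM2l //; lra.
lra.
Qed.

Lemma white_gain D u i : (wyd D u <= i)%N -> a - Y i <= a - Y (wyd D u).
Proof. by move=> h; rewrite lerD2l lerN2 Y_mono. Qed.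

(** * Lowering the degree bounds one step at a time *)

Definition max_white D i := forall u, white D u -> (wyd D u <= i)%N.
Definition max_yellow D i := forall u, yellow D u -> (wyd D u <= i)%N.
Definition max_blue D i := forall u, u \in blue D -> (wyd D u <= i)%N.

(** A white vertex attaining the bound [i.+1] is added to [D]. It gives [a], charges at least
    [d - i.+1] blue vertices, and each of its [i.+1] undominated neighbours gains at least the
    smaller of a white and a yellow gain; the two numerical hypotheses cover the two possible
    minima. *)
Lemma no_white D i j t : irreducible D -> slope D t -> 0 <= t ->
  max_white D i.+1 -> max_yellow D j.+1 ->
  s <= a + t * (d%:R - i.+1%:R) + i.+1%:R * (a - Y i) ->
  s <= a + t * (d%:R - i.+1%:R)
       + i.+1%:R * (Y j.+1 - B j + t * (d%:R - 1 - j.+1%:R)) ->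
  max_white D i.
Proof.
move=> iD ht t0 mW mY hW hY v vW.
have := mW v vW; rewrite leq_eqVlt => /predU1P[wv|//]; exfalso.
have vU := white_undom vW.
set x1 := a - Y i in hW; set x2 := Y j.+1 - B j + t * (d%:R - 1 - j.+1%:R) in hY.
have h x : x <= x1 -> x <= x2 -> a + t * (d%:R - i.+1%:R) + i.+1%:R * x < s.
  (* A white neighbour loses [v] from its at most [i.+1] undominated neighbours, so its new weight
     is at most [Y i]. *)
  move=> l1 l2; have := @irreducible_undom D v t x iD vU ht t0.
  rewrite (wt_white vW) wv => h; apply: le_lt_trans (h _ _).
  - rewrite lerD2r lerD2l ler_wpM2l //; rewrite -wv; exact: white_blue.
  - move=> u evu uW; apply: le_trans l1 _; rewrite lerD2l lerN2 Y_mono //.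
    by have := mW u uW; clear; lia.
  - move=> u evu uY; apply: le_trans l2 _; apply: yellow_gain_undom => //.
    by rewrite mY // andbT (wyd_gt0 vU) // e_sym.
by have [l|/ltW l] := leP x1 x2; [have := h _ (lexx _) l | have := h _ l (lexx _)]; lra.
Qed.

Lemma no_yellow D i j t : irreducible D -> slope D t -> 0 <= t ->
  max_white D i.+1 -> max_yellow D j.+1 ->
  s <= Y j.+1 + t * (d%:R - 1 - j.+1%:R) + j.+1%:R * (a - Y i) ->
  s <= Y j.+1 + t * (d%:R - 1 - j.+1%:R)
       + j.+1%:R * (Y j.+1 - B j + t * (d%:R - 1 - j.+1%:R)) ->
  max_yellow D j.
Proof.
move=> iD ht t0 mW mY hW hY v vY.
have := mY v vY; rewrite leq_eqVlt => /predU1P[wv|//]; exfalso.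
have vU := yellow_undom vY.
set x1 := a - Y i in hW; set x2 := Y j.+1 - B j + t * (d%:R - 1 - j.+1%:R) in hY.
have h x : x <= x1 -> x <= x2 ->
    Y j.+1 + t * (d%:R - 1 - j.+1%:R) + j.+1%:R * x < s.
  move=> l1 l2; have := @irreducible_undom D v t x iD vU ht t0.
  rewrite (wt_yellow vY) wv => h; apply: le_lt_trans (h _ _).
  - rewrite lerD2r lerD2l ler_wpM2l //; rewrite -wv; exact: yellow_blue.
  - move=> u evu uW; apply: le_trans l1 _; rewrite lerD2l lerN2 Y_mono //.
    by have := mW u uW; clear; lia.
  - move=> u evu uY; apply: le_trans l2 _; apply: yellow_gain_undom => //.
    by rewrite mY // andbT (wyd_gt0 vU) // e_sym.
by have [l|/ltW l] := leP x1 x2; [have := h _ (lexx _) l | have := h _ l (lexx _)]; lra.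
Qed.

(** Here [wyd D v] is only known to be at least [k.+1], so the gain per neighbour must be
    nonnegative before the count can be replaced by [k.+1]. *)
Lemma no_blue D i j k t : irreducible D -> slope D t -> 0 <= t ->
  max_white D i -> max_yellow D j ->
  0 <= Y j - B j + t * (d%:R - 2 - j%:R) ->
  s <= B k.+1 + k.+1%:R * (a - Y i) ->
  s <= B k.+1 + k.+1%:R * (Y j - B j + t * (d%:R - 2 - j%:R)) ->
  max_blue D k.
Proof.
move=> iD ht t0 mW mY x20 hW hY v vB; rewrite leqNgt; apply/negP => kv.
set x1 := a - Y i in hW; set x2 := Y j - B j + t * (d%:R - 2 - j%:R) in hY; rewrite -/x2 in x20.
have x10 : 0 <= x1 by rewrite subr_ge0.
have h x : 0 <= x -> x <= x1 -> x <= x2 -> B k.+1 + k.+1%:R * x < s.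
  move=> x0 l1 l2; apply: le_lt_trans (@irreducible_blue_unif D v t x iD vB ht t0 _ _).
  - by rewrite lerD ?B_mono // ler_wpM2r // ler_nat.
  - by move=> u evu uW; apply: le_trans l1 _; apply/white_gain/mW.
  - move=> u evu uY; apply: le_trans l2 _; exact: yellow_gain_blue (mY _ uY) _.
by have [l|/ltW l] := leP x1 x2;
  [have := h _ x10 (lexx _) l | have := h _ x20 l (lexx _)]; lra.
Qed.

Hypothesis B0 : B 0%N = 0.

Lemma wyd1_eq D u v w : (wyd D u <= 1)%N -> v \in undom D -> w \in undom D ->
  e u v -> e u w -> v = w.
Proof.
by move=> /card_le1_eqP h vU wU uv uw; apply: h; rewrite in_setI inE ?uv ?uw.
Qed.

Definition separated D := forall u v, white D u -> yellow D v -> e u v = false.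

(** In a white-yellow edge, the yellow end is the only undominated neighbour of the white end.
    Adding the white end therefore collects exactly one neighbour gain, known to be a yellow one. *)
Lemma no_white_yellow D t : irreducible D -> slope D t -> 0 <= t ->
  max_white D 1 -> max_yellow D 2 ->
  s <= a + t * (d%:R - 1) + (Y 2%N - B 1%N + t * (d%:R - 1 - 2%:R)) -> separated D.
Proof.
move=> iD ht t0 mW mY h u v uW vY; apply/negP => euv.
have uU := white_undom uW; have vU := yellow_undom vY.
have wu : wyd D u = 1%N by have := wyd_gt0 vU euv; have := mW u uW; clear; lia.
have eqv w : w \in undom D -> e u w -> w = v.
  by move=> wU euw; apply: (wyd1_eq _ wU vU euw euv); rewrite wu.
have : wt D u + t * (bluedeg D u)%:R
    + (wyd D u)%:R * (Y 2%N - B 1%N + t * (d%:R - 1 - 2%:R)) < s.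
  apply: irreducible_undom => // w euw wC.
    have wv := eqv w (white_undom wC) euw; move: wC vY; rewrite wv /white /yellow.
    by case/andP => _ /eqP->; rewrite andbF.
  apply: yellow_gain_undom => //.
  by rewrite mY // andbT (wyd_gt0 uU) // e_sym.
have := white_blue uW; rewrite (wt_white uW) wu mul1r => hb.
have : t * (d%:R - 1) <= t * (bluedeg D u)%:R by rewrite ler_wpM2l.
lra.
Qed.

(** Once white and yellow vertices are separated, all undominated neighbours of a yellow vertex are
    yellow, so a single inequality suffices. *)
Lemma no_yellow_sep D j t : irreducible D -> slope D t -> 0 <= t ->
  separated D -> max_yellow D j.+1 ->
  s <= Y j.+1 + t * (d%:R - 1 - j.+1%:R)
       + j.+1%:R * (Y j.+1 - B j + t * (d%:R - 1 - j.+1%:R)) ->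
  max_yellow D j.
Proof.
move=> iD ht t0 white_yellow_separated mY h v vY.
have := mY v vY; rewrite leq_eqVlt => /predU1P[wv|//]; exfalso.
have vU := yellow_undom vY.
have : wt D v + t * (bluedeg D v)%:R
    + (wyd D v)%:R * (Y j.+1 - B j + t * (d%:R - 1 - j.+1%:R)) < s.
  apply: irreducible_undom => // w evw wC.
    by have := white_yellow_separated _ _ wC vY; rewrite e_sym evw.
  apply: yellow_gain_undom => //.
  by rewrite mY // andbT (wyd_gt0 vU) // e_sym.
rewrite (wt_yellow vY) wv.
have : t * (d%:R - 1 - j.+1%:R) <= t * (bluedeg D v)%:R.
  by rewrite ler_wpM2l // -wv yellow_blue.
lra.
Qed.

(** * The gain from adding two vertices *)

Lemma pair_disjoint D v v' : v \notin D -> v' \notin D -> [disjoint [set v; v'] & D].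
Proof.
move=> vD v'D; rewrite -setI_eq0; apply/eqP/setP => x; rewrite in_setI in_set2 in_set0.
by apply/negbTE/negP => /andP[/orP[] /eqP->]; apply/negP.
Qed.

Lemma irreducible2 D v v' (c X : T -> R) (S : seq T) :
  irreducible D -> v \notin D -> v' \notin D -> v != v' -> (forall u, 0 <= c u) ->
  (forall z, z \in blue D -> z != v -> z != v' ->
    \sum_(u in N z :&: lost D [set v; v']) c u <=
    B (wyd D z) - B (wyd D z - #|N z :&: lost D [set v; v']|)%N) ->
  uniq S -> {subset S <= undom D :\: [set v; v']} ->
  (forall u, u \in S -> X u <= wt D u - wt (D :|: [set v; v']) u
     + (if (1 < red (D :|: [set v; v']) u)%N
        then c u * (bluedeg_out D [set v; v'] u)%:R else 0)) ->
  wt D v + wt D v'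
  + \sum_(u in [set v; v'] :&: undom D) c u * (bluedeg_out D [set v; v'] u)%:R
  + \sum_(u <- S) X u < 2 * s.
Proof.
move=> iD vD v'D vv' c0 hc uS SU hX.
have dAD := pair_disjoint vD v'D.
have A0 : [set v; v'] != set0 by apply/set0Pn; exists v; rewrite set21.
have := iD _ A0 dAD; rewrite cards2 vv'; apply: le_lt_trans.
apply: le_trans (gain dAD c0 _ uS SU hX).
  by rewrite big_setU1 ?in_set1 //= big_set1.
by move=> z zB; rewrite in_set2 negb_or => /andP[]; exact: hc.
Qed.

Lemma bluedeg_pair D v v' u : (bluedeg D u <= bluedeg_out D [set v; v'] u
  + ((v \in blue D) && e u v) + ((v' \in blue D) && e u v'))%N.
Proof.
have h x : #|(N u :&: blue D) :&: [set x]| = ((x \in blue D) && e u x) :> nat.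
  case xB: (_ && _).
    have -> : N u :&: blue D :&: [set x] = [set x]; last by rewrite cards1.
    by apply/setIidPr; rewrite sub1set in_setI inE andbC.
  apply: eq_card0 => y; rewrite !in_setI in_set1 inE.
  by apply/negP => /andP[/andP[euy yB] /eqP yx]; rewrite -yx yB euy in xB.
rewrite -!h /bluedeg_out setIDA -addnA.
apply: (@leq_trans (#|(N u :&: blue D) :\: [set v; v']| +
  #|(N u :&: blue D :&: [set v]) :|: (N u :&: blue D :&: [set v'])|)); last first.
  by rewrite leq_add2l leq_card_setU.
by rewrite -setIUr addnC cardsID.
Qed.

Lemma gain_white D A u v k x : [disjoint A & D] -> white D u -> u \notin A ->
  v \in A -> e u v -> (wyd (D :|: A) u <= k)%N -> 0 <= x ->
  a - Y k <= wt D u - wt (D :|: A) u + (if (1 < red (D :|: A) u)%N then x else 0).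
Proof.
move=> dAD uW uA vA euv hk x0; rewrite (wt_white uW) -addrA lerD2l.
have red1 := red_gt0 dAD vA euv.
rewrite -[leLHS]addr0 lerD ?lerN2 //; last by case: ifP.
rewrite wt_undom_le //; last exact: leq_ltn_trans red1.
by rewrite in_setU negb_or uA andbT; case/andP: uW.
Qed.

(** Two added neighbours turn a white vertex blue at once, so it drops to a blue weight and also
    collects its charges [x]. *)
Lemma gain_white2 D A u v v' k x : [disjoint A & D] -> white D u -> u \notin A ->
  v \in A -> v' \in A -> v != v' -> e u v -> e u v' -> (wyd (D :|: A) u <= k)%N ->
  a - B k + x <= wt D u - wt (D :|: A) u + (if (1 < red (D :|: A) u)%N then x else 0).
Proof.
move=> dAD uW uA vA v'A vv' euv euv' hk; rewrite (wt_white uW).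
have red2 := leq_trans (leq_addl _ _) (red_gt1 dAD vA v'A vv' euv euv').
rewrite red2 lerD2r lerD2l lerN2 wt_blue_le //.
by rewrite in_setU negb_or uA andbT; case/andP: uW.
Qed.

Lemma gain_yellow D A u v k x : [disjoint A & D] -> yellow D u -> u \notin A ->
  v \in A -> e u v -> (wyd (D :|: A) u <= k)%N ->
  Y (wyd D u) - B k + x
  <= wt D u - wt (D :|: A) u + (if (1 < red (D :|: A) u)%N then x else 0).
Proof.
move=> dAD uY uA vA euv hk; rewrite (wt_yellow uY).
case/andP: uY => uD /eqP r1; have := red_gt0 dAD vA euv; rewrite r1 => red2.
rewrite red2 lerD2r lerD2l lerN2 wt_blue_le //.
by rewrite in_setU negb_or uA andbT.
Qed.

Lemma bluedeg_cast D v v' u n : (bluedeg D u <= bluedeg_out D [set v; v'] u + n)%N ->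
  (bluedeg D u)%:R - n%:R <= (bluedeg_out D [set v; v'] u)%:R :> R.
Proof. by rewrite -(ler_nat R) natrD; lra. Qed.

Lemma adj_neq u v : e u v -> u != v.
Proof. by apply: contraTneq => ->; rewrite e_irr. Qed.

Lemma blue_undom_neq D u v : v \in blue D -> u \in undom D -> u != v.
Proof. by move=> vB; apply: contraTneq => ->; exact: blue_undom. Qed.

(** The pair added is [v] and [u']. Their common neighbour [u] becomes blue with no undominated
    neighbour left, so its weight falls from [a] to [B 0], which is 0. It charges at least [d - 2]
    blue vertices other than [v], and [u'] charges at least [d - 1], giving [2 * d - 3] charges; the
    other undominated neighbours of [v] gain [x] each. *)
Lemma pair_out D v u u' t x : irreducible D -> slope D t -> 0 <= t ->
  max_white D 1 ->
  v \in blue D -> white D u -> white D u' -> e v u -> e u u' -> ~~ e v u' ->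
  (forall w, e v w -> w != u -> white D w -> x <= a - Y (wyd D w)) ->
  (forall w, e v w -> w != u -> yellow D w ->
     x <= Y (wyd D w) - B (wyd D w) + t * ((bluedeg D w)%:R - 1)) ->
  B (wyd D v) + 2 * a + t * (2 * d%:R - 3) + ((wyd D v)%:R - 1) * x < 2 * s.
Proof.
move=> iD ht t0 mW vB uW u'W evu euu' nvu' hW hY.
have [[vD uU] u'U] := (blue_notin vB, white_undom uW, white_undom u'W).
have [uD u'D] := (undom_notin uU, undom_notin u'U).
have vu' : v != u' by rewrite eq_sym (blue_undom_neq vB).
have dAD := pair_disjoint vD u'D.
have u'B : u' \in blue D = false by apply: contraTF u'U; exact: blue_undom.
have euv : e u v by rewrite e_sym.
pose X w := if w == u then a + t * (d%:R - 2) else x.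
have nA w : e v w -> w \notin [set v; u'].
  move=> evw; rewrite in_set2 negb_or eq_sym adj_neq //=.
  by apply: contraNneq nvu' => <-.
have hS : {subset enum (N v :&: undom D) <= undom D :\: [set v; u']}.
  by move=> w; rewrite mem_enum in_setI inE in_setD => /andP[/nA-> ->].
have hX w : w \in enum (N v :&: undom D) -> X w <= wt D w - wt (D :|: [set v; u']) w
  + (if (1 < red (D :|: [set v; u']) w)%N
     then t * (bluedeg_out D [set v; u'] w)%:R else 0).
  rewrite mem_enum in_setI inE => /andP[evw wU].
  have ewv : e w v by rewrite e_sym.
  rewrite /X; case: eqP => [->|/eqP wu].
    have hwyd : (wyd (D :|: [set v; u']) u <= 0)%N.
      apply: leq_trans (wyd_pred u'U (set22 v u') euu') _.
      by have := mW u uW; clear; lia.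
    have := gain_white2 (t * (bluedeg_out D [set v; u'] u)%:R) dAD uW (nA _ evu)
      (set21 v u') (set22 v u') vu' euv euu' hwyd.
    rewrite B0 subr0; apply: le_trans; rewrite lerD2l ler_wpM2l //.
    have := @bluedeg_pair D v u' u; rewrite u'B vB euv /= addn0.
    move=> /bluedeg_cast hb; have := white_blue uW.
    have : (wyd D u)%:R <= 1 :> R by rewrite (ler_nat R _ 1) mW.
    lra.
  have hwyd := wyd_mono w (subsetUl D [set v; u']).
  move: wU; rewrite undomE => /orP[] wC.
    apply: le_trans (hW w evw wu wC) _.
    by apply: (gain_white dAD wC (nA _ evw) (set21 _ _)); rewrite ?mulr_ge0.
  apply: le_trans (hY w evw wu wC) _.
  apply: le_trans (gain_yellow _ dAD wC (nA _ evw) (set21 _ _) ewv hwyd).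
  rewrite lerD2l ler_wpM2l //.
  have := @bluedeg_pair D v u' w; rewrite u'B vB ewv /= addn0.
  by move=> /bluedeg_cast.
have hc z : z \in blue D -> z != v -> z != u' -> \sum_(w in N z :&: lost D [set v; u']) t
    <= B (wyd D z) - B (wyd D z - #|N z :&: lost D [set v; u']|)%N.
  by move=> zB _ _; exact: slope_charge.
have := irreducible2 iD vD u'D vu' (fun=> t0) hc (enum_uniq _) hS hX.
have -> : [set v; u'] :&: undom D = [set u'].
  apply/setP => w; rewrite in_setI in_set2 in_set1.
  case: eqP => [->|_] /=; first by rewrite (negbTE (blue_undom vB)) (negbTE vu').
  by case: eqP => [->|].
rewrite big_set1 (wt_blue vB) (wt_white u'W) big_enum .
have -> : \sum_(w in N v :&: undom D) X w =
    a + t * (d%:R - 2) + ((wyd D v)%:R - 1) * x.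
  have uN : u \in N v :&: undom D by rewrite in_setI inE evu.
  rewrite (bigD1 u) //= {1}/X eqxx (eq_bigr (fun=> x)) => [|w /andP[_ /negbTE wu]]; last first.
    by rewrite /X wu.
  rewrite (eq_bigl (mem ((N v :&: undom D) :\ u))) => [|w]; last first.
    by rewrite /= in_setD1 andbC.
  rewrite sumr_const -[x *+ _]mulr_natl /wyd (cardsD1 u (N v :&: undom D)) uN natrD.
  by congr (_ + _ * x); rewrite addrAC subrr add0r.
have hu' : d%:R - 1 <= (bluedeg_out D [set v; u'] u')%:R :> R.
  have := @bluedeg_pair D v u' u'; rewrite u'B [e u' v]e_sym (negbTE nvu') andbF /= !addn0.
  rewrite -(ler_nat R) => hb; have := white_blue u'W.
  have : (wyd D u')%:R <= 1 :> R by rewrite (ler_nat R _ 1) mW.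
  lra.
have h1 : t * (d%:R - 1) <= t * (bluedeg_out D [set v; u'] u')%:R by rewrite ler_wpM2l.
by move=> H; lra.
Qed.

Lemma card3_split (S : {set T}) p p' : #|S| = 3%N -> p \in S -> p' \in S -> p != p' ->
  exists w, [/\ w \in S, w != p, w != p' & forall u, u \in S -> [|| u == p, u == p' | u == w]].
Proof.
move=> S3 pS p'S pp'.
have p'S1 : p' \in S :\ p by rewrite in_setD1 eq_sym pp'.
have /cards1P[w hw] : #|(S :\ p) :\ p'| == 1%N.
  by move: S3; rewrite (cardsD1 p) pS (cardsD1 p' (S :\ p)) p'S1; clear; lia.
have : w \in (S :\ p) :\ p' by rewrite hw set11.
rewrite !in_setD1 => /and3P[wp' wp wS]; exists w; split => // u uS.
have : u \in (S :\ p) :\ p' = (u == w) by rewrite hw in_set1.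
by rewrite !in_setD1 uS andbT => <-; case: (u == p) (u == p') => [] [].
Qed.

Lemma charge_le D A z (c : T -> R) k : (wyd D z <= k.+1)%N ->
  (forall u, e z u -> c u <= B k.+1 - B k) ->
  \sum_(u in N z :&: lost D A) c u
  <= B (wyd D z) - B (wyd D z - #|N z :&: lost D A|)%N.
Proof.
move=> hz hc; apply: le_trans (B_drop hz (lost_le D A z)).
rewrite mulr_natr -sumr_const; apply: ler_sum => u.
by rewrite in_setI inE => /andP[/hc].
Qed.

Lemma wyd0_pair D A u u' : (wyd D u <= 1)%N -> u' \in undom D -> e u u' ->
  u' \notin undom (D :|: A) -> wyd (D :|: A) u = 0%N.
Proof.
move=> wu u'U euu' u'U'; rewrite wyd_setU; apply/eqP.
have : (0 < #|N u :&: lost D A|)%N; last by move: wu; clear; lia.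
by rewrite card_gt0; apply/set0Pn; exists u'; rewrite in_setI in_setD u'U u'U' inE euu'.
Qed.

(** The pair added is [v] and [p]; then [p'] gains all of [a]. Any other blue vertex meeting the
    edge has at most two undominated neighbours, so [p] and [p'] may charge the larger amount
    [B 2 - B 1], while [w] charges [B 3 - B 2]. *)
Lemma pair_in D v p p' w x : irreducible D -> max_white D 1 -> max_blue D 3 ->
  v \in blue D -> wyd D v = 3%N -> white D p -> white D p' ->
  e v p -> e v p' -> e p p' -> e v w -> w != p -> w != p' -> w \in undom D ->
  (forall z, z \in blue D -> z != v -> e z p || e z p' -> (wyd D z <= 2)%N) ->
  (white D w -> x <= a - Y (wyd D w)) ->
  (yellow D w -> x <= Y (wyd D w) - B (wyd D w)
     + (B 3%N - B 2%N) * ((bluedeg D w)%:R - 1)) ->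
  B 3%N + 2 * a + 2 * (B 2%N - B 1%N) * (d%:R - 2) + x < 2 * s.
Proof.
move=> iD mW mB vB wv3 pW p'W evp evp' epp' evw wp wp' wU hz hW hY.
have [pU p'U] := (white_undom pW, white_undom p'W).
have [vD pD] := (blue_notin vB, undom_notin pU).
have vp : v != p by rewrite eq_sym (blue_undom_neq vB).
have vp' : v != p' by rewrite eq_sym (blue_undom_neq vB).
have pp' := adj_neq epp'; rewrite e_sym in epp'.
have dAD := pair_disjoint vD pD.
have pB : p \in blue D = false by apply: contraTF pU; exact: blue_undom.
have t2 : 0 <= B 2%N - B 1%N by rewrite subr_ge0 B_mono.
have t3 : 0 <= B 3%N - B 2%N by rewrite subr_ge0 B_mono.
have t23 := B_concave 1%N.
pose c u := if (u == p) || (u == p') then B 2%N - B 1%N else B 3%N - B 2%N.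
pose X u := if u == p' then a + (B 2%N - B 1%N) * (d%:R - 2) else x.
have c0 u : 0 <= c u by rewrite /c; case: ifP.
have hc z : z \in blue D -> z != v -> z != p -> \sum_(u in N z :&: lost D [set v; p]) c u
    <= B (wyd D z) - B (wyd D z - #|N z :&: lost D [set v; p]|)%N.
  move=> zB zv _; case ezp: (e z p || e z p').
    by apply: (@charge_le D [set v; p] z c 1%N (hz z zB zv ezp)) => u _; rewrite /c; case: ifP.
  apply: (@charge_le D _ z c 2%N (mB z zB)) => u ezu; rewrite /c.
  have -> : (u == p) || (u == p') = false.
    by apply: contraFF ezp => /orP[] /eqP <-; rewrite ezu ?orbT.
  by [].
have uS : uniq [:: p'; w] by rewrite /= inE eq_sym wp'.
have vw : v != w by rewrite adj_neq.
have SU : {subset [:: p'; w] <= undom D :\: [set v; p]}.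
  move=> u; rewrite in_cons mem_seq1 => /orP[] /eqP->; rewrite in_setD in_set2 negb_or.
    by rewrite p'U ![p' == _]eq_sym vp' pp'.
  by rewrite wU wp eq_sym vw.
have hX u : u \in [:: p'; w] -> X u <= wt D u - wt (D :|: [set v; p]) u
    + (if (1 < red (D :|: [set v; p]) u)%N
       then c u * (bluedeg_out D [set v; p] u)%:R else 0).
  move=> uS'; have := SU u uS'; rewrite in_setD => /andP[uA uU].
  move: uS'; rewrite in_cons mem_seq1 => /orP[] /eqP ue; rewrite {}ue in uA uU *.
    have hwyd : (wyd (D :|: [set v; p]) p' <= 0)%N.
      apply: leq_trans (wyd_pred pU (set22 v p) epp') _.
      by have := mW p' p'W; clear; lia.
    have ep'v : e p' v by rewrite e_sym.
    have := gain_white2 (c p' * (bluedeg_out D [set v; p] p')%:R) dAD p'W uA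
      (set21 v p) (set22 v p) vp ep'v epp' hwyd.
    rewrite B0 subr0; apply: le_trans; rewrite /X /c eqxx orbT lerD2l ler_wpM2l //.
    have := @bluedeg_pair D v p p'; rewrite pB vB ep'v /= addn0.
    move=> /bluedeg_cast hb; have := white_blue p'W.
    have : (wyd D p')%:R <= 1 :> R by rewrite (ler_nat R _ 1) mW.
    lra.
  have hwyd := wyd_mono w (subsetUl D [set v; p]).
  have ewv : e w v by rewrite e_sym.
  rewrite /X (negbTE wp'); move: wU; rewrite undomE => /orP[] wC.
    apply: le_trans (hW wC) _.
    by apply: (gain_white dAD wC uA (set21 _ _)); rewrite ?mulr_ge0.
  apply: le_trans (hY wC) _.
  apply: le_trans (gain_yellow _ dAD wC uA (set21 _ _) ewv hwyd).
  rewrite /c (negbTE wp) (negbTE wp') lerD2l ler_wpM2l //.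
  have := @bluedeg_pair D v p w; rewrite pB vB ewv /= addn0.
  by move=> /bluedeg_cast.
have := irreducible2 iD vD pD vp c0 hc uS SU hX.
have -> : [set v; p] :&: undom D = [set p].
  apply/setP => u; rewrite in_setI in_set2 in_set1.
  case: eqP => [->|_] /=; first by rewrite (negbTE (blue_undom vB)) (negbTE vp).
  by case: eqP => [->|].
rewrite big_set1 (wt_blue vB) wv3 (wt_white pW) !big_cons big_nil /X /c !eqxx /= (negbTE wp').
have hp : d%:R - 2 <= (bluedeg_out D [set v; p] p)%:R :> R.
  have := @bluedeg_pair D v p p; rewrite pB vB [e p v]e_sym evp /= addn0.
  move=> /bluedeg_cast hb; have := white_blue pW.
  have : (wyd D p)%:R <= 1 :> R by rewrite (ler_nat R _ 1) mW.
  lra.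
have h1 : (B 2%N - B 1%N) * (d%:R - 2)
    <= (B 2%N - B 1%N) * (bluedeg_out D [set v; p] p)%:R by rewrite ler_wpM2l.
by move=> H; lra.
Qed.

(** The common neighbour [p] becomes blue of weight [B 0], which is 0. Of its at least [d - 1] blue
    neighbours, two are [v] and [v'], now in the set. *)
Lemma blue_pair_gain D v v' p (c : T -> R) : max_white D 1 ->
  v \in blue D -> v' \in blue D -> v != v' -> white D p ->
  e p v -> e p v' -> wyd (D :|: [set v; v']) p = 0%N -> 0 <= c p ->
  a + c p * (d%:R - 3) <= wt D p - wt (D :|: [set v; v']) p
    + (if (1 < red (D :|: [set v; v']) p)%N
       then c p * (bluedeg_out D [set v; v'] p)%:R else 0).
Proof.
move=> mW vB v'B vv' pW epv epv' wp0 c0.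
have dAD := pair_disjoint (blue_notin vB) (blue_notin v'B).
have pA : p \notin [set v; v'].
  by rewrite in_set2 negb_or !(blue_undom_neq _ (white_undom pW)).
have hwyd : (wyd (D :|: [set v; v']) p <= 0)%N by rewrite wp0.
have := gain_white2 (c p * (bluedeg_out D [set v; v'] p)%:R) dAD pW pA
  (set21 v v') (set22 v v') vv' epv epv' hwyd.
rewrite B0 subr0; apply: le_trans; rewrite lerD2l ler_wpM2l //.
have := @bluedeg_pair D v v' p; rewrite vB v'B epv epv' /= -addnA.
move=> /bluedeg_cast hb; have := white_blue pW.
have : (wyd D p)%:R <= 1 :> R by rewrite (ler_nat R _ 1) mW.
by lra.
Qed.

Lemma common_nbr_dominated D v v' p : v \in blue D -> v' \in blue D -> v != v' ->
  e p v -> e p v' -> p \notin undom (D :|: [set v; v']).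
Proof.
move=> vB v'B vv' epv epv'.
have dAD := pair_disjoint (blue_notin vB) (blue_notin v'B).
rewrite inE negb_and -ltnNge.
by rewrite (leq_trans (leq_addl _ _) (red_gt1 dAD (set21 v v') (set22 v v') vv' epv epv')) orbT.
Qed.

Lemma blue_pair_undom D v v' : v \in blue D -> v' \in blue D ->
  [set v; v'] :&: undom D = set0.
Proof.
move=> vB v'B; apply/setP => u; rewrite in_setI in_set2 in_set0.
by apply/negbTE/negP => /andP[/orP[] /eqP-> h]; move: h; apply/negP; exact: blue_undom.
Qed.

(** Adding [v] and [v'] makes all of [p], [p'], [w] blue. A blue vertex with three undominated
    neighbours sees both [p] and [p'] or neither, so the two may share the drop from [B 3] to [B 1]
    equally. *)
Lemma blue_pair_same D v v' p p' w x : irreducible D -> max_white D 1 ->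
  max_blue D 3 ->
  v \in blue D -> v' \in blue D -> v != v' -> wyd D v = 3%N -> wyd D v' = 3%N ->
  white D p -> white D p' -> e p p' ->
  e v p -> e v p' -> e v w -> e v' p -> e v' p' -> e v' w ->
  w != p -> w != p' -> w \in undom D ->
  (forall z, z \in blue D -> wyd D z = 3%N -> e z p = e z p') ->
  (white D w -> x <= a - B (wyd D w) + (B 3%N - B 2%N) * ((bluedeg D w)%:R - 2)) ->
  (yellow D w -> x <= Y (wyd D w) - B (wyd D w)
     + (B 3%N - B 2%N) * ((bluedeg D w)%:R - 2)) ->
  2 * B 3%N + 2 * a + (B 3%N - B 1%N) * (d%:R - 3) + x < 2 * s.
Proof.
move=> iD mW mB vB v'B vv' wv3 wv'3 pW p'W epp' evp evp' evw ev'p ev'p' ev'w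
  wp wp' wU hz hW hY.
have [pU p'U] := (white_undom pW, white_undom p'W).
have [vD v'D] := (blue_notin vB, blue_notin v'B).
have pp' := adj_neq epp'.
have dAD := pair_disjoint vD v'D.
have t2 : 0 <= B 2%N - B 1%N by rewrite subr_ge0 B_mono.
have t3 : 0 <= B 3%N - B 2%N by rewrite subr_ge0 B_mono.
have t23 := B_concave 1%N; have t12 := B_concave 0%N.
(* The average of the second and third increments of [B], hence at most [B 2 - B 1]; a blue vertex
   with at most two undominated neighbours can pay it as well. *)
pose h := (B 3%N - B 1%N) / 2.
pose c u := if (u == p) || (u == p') then h else B 3%N - B 2%N.
pose X u := if (u == p) || (u == p') then a + h * (d%:R - 3) else x.
have hh : h <= B 2%N - B 1%N /\ 0 <= h by rewrite /h; split; lra.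
have c0 u : 0 <= c u by rewrite /c; case: ifP; case: hh.
have epv : e p v by rewrite e_sym.
have ep'v : e p' v by rewrite e_sym.
have epv' : e p v' by rewrite e_sym.
have ep'v' : e p' v' by rewrite e_sym.
have ewv : e w v by rewrite e_sym.
have ewv' : e w v' by rewrite e_sym.
have pout := common_nbr_dominated vB v'B vv' epv epv'.
have p'out := common_nbr_dominated vB v'B vv' ep'v ep'v'.
have hc z : z \in blue D -> z != v -> z != v' ->
    \sum_(u in N z :&: lost D [set v; v']) c u
    <= B (wyd D z) - B (wyd D z - #|N z :&: lost D [set v; v']|)%N.
  move=> zB _ _; have := mB z zB; rewrite leq_eqVlt => /predU1P[wz|wz]; last first.
    by apply: (@charge_le D _ z c 1%N) => // u _; rewrite /c; case: ifP => _ //; case: hh.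
  have := hz z zB wz; case ezp: (e z p) => /esym ezp'; last first.
    apply: (@charge_le D _ z c 2%N (mB z zB)) => u ezu; rewrite /c.
    have -> : (u == p) || (u == p') = false.
      by apply/negbTE/negP => /orP[] /eqP ue; move: ezu; rewrite ue ?ezp ?ezp'.
    by [].
  set M := N z :&: _; have pM : p \in M by rewrite in_setI in_setD pU pout inE ezp.
  have p'M : p' \in M by rewrite in_setI in_setD p'U p'out inE ezp'.
  have p'M1 : p' \in M :\ p by rewrite in_setD1 p'M eq_sym pp'.
  have cM := cardsD1 p M; have cM1 := cardsD1 p' (M :\ p); rewrite pM p'M1 in cM cM1.
  have hM : (#|M| <= 3)%N by rewrite -wz lost_le.
  rewrite (big_setD1 p) //= (big_setD1 p') //= {1 2}/c !eqxx orbT /= wz.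
  have -> : \sum_(i in (M :\ p) :\ p') c i = (B 3%N - B 2%N) * (#|(M :\ p) :\ p'|)%:R.
    rewrite mulr_natr -sumr_const; apply: eq_bigr => i.
    by rewrite !in_setD1 /c => /and3P[/negbTE-> /negbTE->].
  (* If only [p] and [p'] are lost, the drop is exactly [2 * h]. If the third neighbour is lost too,
     the drop is [B 3], and the extra charge [B 3 - B 2] is at most [B 1] by concavity. *)
  rewrite cM cM1; move: cM cM1 hM; case: #|(M :\ p) :\ p'| => [|[|k]] cM cM1 hM; last first.
    by move: cM cM1 hM; clear; lia.
    by rewrite /h /=; lra.
  by rewrite /h /=; lra.
have uS : uniq [:: p; p'; w] by rewrite /= !inE !negb_or pp' ![_ == w]eq_sym wp wp'.
have SU : {subset [:: p; p'; w] <= undom D :\: [set v; v']}.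
  move=> u; rewrite 2!in_cons mem_seq1 => uu; have uU : u \in undom D by case/or3P: uu => /eqP->.
  by rewrite in_setD in_set2 negb_or !(blue_undom_neq _ uU).
have hX u : u \in [:: p; p'; w] -> X u <= wt D u - wt (D :|: [set v; v']) u
    + (if (1 < red (D :|: [set v; v']) u)%N
       then c u * (bluedeg_out D [set v; v'] u)%:R else 0).
  move=> uS'; have := SU u uS'; rewrite in_setD => /andP[uA uU].
  move: uS'; rewrite 2!in_cons mem_seq1 => /or3P[] /eqP ue; rewrite {}ue in uA uU *.
  - have -> : X p = a + c p * (d%:R - 3) by rewrite /X /c eqxx.
    by apply: blue_pair_gain => //; apply: (wyd0_pair (mW p pW) p'U epp').
  - have -> : X p' = a + c p' * (d%:R - 3) by rewrite /X /c eqxx orbT.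
    apply: blue_pair_gain => //; apply: (wyd0_pair (mW p' p'W) pU) => //.
    by rewrite e_sym.
  have hwyd := wyd_mono w (subsetUl D [set v; v']).
  have hb : (bluedeg D w)%:R - 2 <= (bluedeg_out D [set v; v'] w)%:R :> R.
    by apply: bluedeg_cast; have := @bluedeg_pair D v v' w; rewrite vB v'B ewv ewv' -addnA.
  have hb3 : (B 3%N - B 2%N) * ((bluedeg D w)%:R - 2)
      <= c w * (bluedeg_out D [set v; v'] w)%:R.
    by rewrite /c (negbTE wp) (negbTE wp') ler_wpM2l.
  rewrite /X (negbTE wp) (negbTE wp') /=; move: wU; rewrite undomE => /orP[] wC.
    apply: le_trans (hW wC) _.
    apply: le_trans (gain_white2 _ dAD wC uA (set21 v v') (set22 v v') vv' ewv ewv' hwyd).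
    by rewrite lerD2l.
  apply: le_trans (hY wC) _.
  apply: le_trans (gain_yellow _ dAD wC uA (set21 _ _) ewv hwyd).
  by rewrite lerD2l.
have := irreducible2 iD vD v'D vv' c0 hc uS SU hX.
rewrite blue_pair_undom // big_set0 (wt_blue vB) (wt_blue v'B) wv3 wv'3.
rewrite !big_cons big_nil /X !eqxx orbT /= (negbTE wp) (negbTE wp') /= /h.
by move=> H; lra.
Qed.

(** Adding [v] and [v'] makes [p] and [p'] blue of weight 0. Each of [w], [w'] has just one
    neighbour in the pair, so it contributes the same gain [x] as in the addition of one blue
    vertex. *)
Lemma blue_pair_diff D v v' p p' w w' t x : irreducible D -> max_white D 1 ->
  slope D t -> 0 <= t ->
  v \in blue D -> v' \in blue D -> v != v' -> wyd D v = 3%N -> wyd D v' = 3%N ->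
  white D p -> white D p' -> e p p' ->
  e v p -> e v p' -> e v w -> e v' p -> e v' p' -> e v' w' ->
  ~~ e v' w -> ~~ e v w' -> w \in undom D -> w' \in undom D ->
  (forall u, u \in [:: w; w'] -> white D u -> x <= a - Y (wyd D u)) ->
  (forall u, u \in [:: w; w'] -> yellow D u ->
     x <= Y (wyd D u) - B (wyd D u) + t * ((bluedeg D u)%:R - 1)) ->
  2 * B 3%N + 2 * a + 2 * t * (d%:R - 3) + 2 * x < 2 * s.
Proof.
move=> iD mW ht t0 vB v'B vv' wv3 wv'3 pW p'W epp' evp evp' evw ev'p ev'p' ev'w'
  nv'w nvw' wU w'U hW hY.
have [pU p'U] := (white_undom pW, white_undom p'W).
have [vD v'D] := (blue_notin vB, blue_notin v'B).
have dAD := pair_disjoint vD v'D.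
have wp : w != p by apply: contraNneq nv'w => ->.
have wp' : w != p' by apply: contraNneq nv'w => ->.
have w'p : w' != p by apply: contraNneq nvw' => ->.
have w'p' : w' != p' by apply: contraNneq nvw' => ->.
have ww' : w != w' by apply: contraNneq nvw' => <-.
have epv : e p v by rewrite e_sym.
have ep'v : e p' v by rewrite e_sym.
have epv' : e p v' by rewrite e_sym.
have ep'v' : e p' v' by rewrite e_sym.
have pout := common_nbr_dominated vB v'B vv' epv epv'.
have p'out := common_nbr_dominated vB v'B vv' ep'v ep'v'.
pose X u := if (u == p) || (u == p') then a + t * (d%:R - 3) else x.
have hc z : z \in blue D -> z != v -> z != v' ->
    \sum_(u in N z :&: lost D [set v; v']) t
    <= B (wyd D z) - B (wyd D z - #|N z :&: lost D [set v; v']|)%N.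
  by move=> zB _ _; exact: slope_charge.
have uS : uniq [:: p; p'; w; w'].
  by rewrite /= !inE !negb_or adj_neq // ![p == _]eq_sym ![p' == _]eq_sym wp wp' w'p w'p' ww'.
have SU : {subset [:: p; p'; w; w'] <= undom D :\: [set v; v']}.
  move=> u; rewrite 3!in_cons mem_seq1 => uu.
  have uU : u \in undom D by case/or4P: uu => /eqP->.
  by rewrite in_setD in_set2 negb_or !(blue_undom_neq _ uU).
have hx u : u \in [:: w; w'] -> u \notin [set v; v'] -> u \in undom D ->
    x <= wt D u - wt (D :|: [set v; v']) u
    + (if (1 < red (D :|: [set v; v']) u)%N
       then t * (bluedeg_out D [set v; v'] u)%:R else 0).
  move=> uw uA uU; have hwyd := wyd_mono u (subsetUl D [set v; v']).
  have [r [rA eur hb]] : exists r, [/\ r \in [set v; v'], e u r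
      & (bluedeg D u <= bluedeg_out D [set v; v'] u + 1)%N].
    move: uw; rewrite in_cons mem_seq1 => /orP[] /eqP->.
      exists v; rewrite set21 e_sym evw; split=> //.
      by have := @bluedeg_pair D v v' w; rewrite vB v'B [e w v]e_sym [e w v']e_sym evw
        (negbTE nv'w) addn0.
    exists v'; rewrite set22 e_sym ev'w'; split=> //.
    by have := @bluedeg_pair D v v' w'; rewrite vB v'B [e w' v]e_sym [e w' v']e_sym ev'w'
      (negbTE nvw') addn0.
  move: uU; rewrite undomE => /orP[] uC.
    apply: le_trans (hW u uw uC) _.
    by apply: (gain_white dAD uC uA rA); rewrite ?mulr_ge0.
  apply: le_trans (hY u uw uC) _.
  apply: le_trans (gain_yellow _ dAD uC uA rA eur hwyd).
  by rewrite lerD2l ler_wpM2l //; exact: (bluedeg_cast hb).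
have hX u : u \in [:: p; p'; w; w'] -> X u <= wt D u - wt (D :|: [set v; v']) u
    + (if (1 < red (D :|: [set v; v']) u)%N
       then t * (bluedeg_out D [set v; v'] u)%:R else 0).
  move=> uS'; have := SU u uS'; rewrite in_setD => /andP[uA uU].
  move: uS'; rewrite 3!in_cons mem_seq1 => /or4P[] /eqP ue; rewrite {}ue in uA uU *.
  - have -> : X p = a + t * (d%:R - 3) by rewrite /X eqxx.
    apply: (@blue_pair_gain D v v' p (fun=> t)) => //.
    exact: (wyd0_pair (mW p pW) p'U epp').
  - have -> : X p' = a + t * (d%:R - 3) by rewrite /X eqxx orbT.
    apply: (@blue_pair_gain D v v' p' (fun=> t)) => //.
    by apply: (wyd0_pair (mW p' p'W) pU) => //; rewrite e_sym.
  - by rewrite /X (negbTE wp) (negbTE wp') hx // !inE eqxx.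
  - by rewrite /X (negbTE w'p) (negbTE w'p') hx // !inE eqxx orbT.
have := irreducible2 iD vD v'D vv' (fun=> t0) hc uS SU hX.
rewrite blue_pair_undom // big_set0 (wt_blue vB) (wt_blue v'B) wv3 wv'3.
rewrite !big_cons big_nil /X !eqxx orbT /= (negbTE wp) (negbTE wp') (negbTE w'p) (negbTE w'p') /=.
by move=> H; lra.
Qed.

(** * Exclusion of undominated vertices *)

Section Inequalities.

Hypothesis d6 : (6 <= d)%N.
Hypothesis h9 : a + d%:R * (a - Y (d - 1)%N) >= s.
Hypothesis h10 : a + d%:R * (Y d.+1 - B d) >= s.
Hypothesis h11 : Y d.+1 + (d%:R + 1) * (a - Y (d - 2)%N) >= s.
Hypothesis h12 : Y d.+1 + (d%:R + 1) * (Y d.+1 - B d) >= s.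
Hypothesis h13 : a + (d%:R - 1) * (a - Y (d - 2)%N) >= s.
Hypothesis h14 : a + (d%:R - 1) * (Y d - B (d - 1)%N) >= s.
Hypothesis h15 : Y d + d%:R * (a - Y (d - 3)%N) >= s.
Hypothesis h16 : Y d + d%:R * (Y d - B (d - 1)%N) >= s.
Hypothesis h17 : B d.+1 + (d%:R + 1) * (a - Y (d - 2)%N) >= s.
Hypothesis h18 : B d.+1 + (d%:R + 1) * (Y (d - 1)%N - B (d - 1)%N) >= s.
Hypothesis h19 : a + (d%:R - 1) * (B 3%N - B 2%N) + (Y 2%N - B 1%N)
         + (d%:R - 3) * (B 3%N - B 2%N) >= s.
Hypothesis h20 : Y 2%N + (d%:R - 3) * (B 3%N - B 2%N)
         + 2 * (Y 2%N - B 1%N + (d%:R - 3) * (B 3%N - B 2%N)) >= s.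
Hypothesis h21 : a + 1 / 2 * B 3%N + (d%:R - 3 / 2) * (B 3%N - B 2%N)
         + (a - Y 1%N) >= s.
Hypothesis h22 : a + 1 / 2 * B 3%N + (d%:R - 3 / 2) * (B 3%N - B 2%N)
         + (Y 1%N - B 1%N + (d%:R - 3) * (B 3%N - B 2%N)) >= s.
Hypothesis h23 : 3 / 2 * a + 1 / 2 * B 3%N - 1 / 2 * Y 0%N
         + (d%:R - 2) * (B 2%N - B 1%N) >= s.
Hypothesis h24 : a + 1 / 2 * B 3%N + 1 / 2 * Y 1%N - 1 / 2 * B 1%N
         + (d%:R - 2) * (B 2%N - B 1%N)
         + 1 / 2 * (d%:R - 3) * (B 3%N - B 2%N) >= s.
Hypothesis h25 : 3 / 2 * a + B 3%N + 1 / 2 * (d%:R - 3) * (B 3%N - B 1%N)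
         + 1 / 2 * (d%:R - 2) * (B 3%N - B 2%N) >= s.
Hypothesis h26 : a + B 3%N + 1 / 2 * Y 1%N - 1 / 2 * B 1%N
         + 1 / 2 * (d%:R - 3) * (B 3%N - B 1%N)
         + 1 / 2 * (d%:R - 4) * (B 3%N - B 2%N) >= s.
Hypothesis h27 : B 3%N + 3 * (a - Y 0%N) >= s.
Hypothesis h28 : B 3%N + 3 * (Y 1%N - B 1%N + (d%:R - 3) * (B 3%N - B 2%N)) >= s.
Hypothesis h29 : 2 * Y 1%N + 2 * (d%:R - 2) * (B 2%N - B 1%N) >= s.
Hypothesis h30 : a + 1 / 2 * B 2%N + (d%:R - 3 / 2) * (B 2%N - B 1%N)
         + 1 / 2 * (a - Y 1%N) >= s.
Hypothesis h31 : a + 1 / 2 * B 2%N + (d%:R - 3 / 2) * (B 2%N - B 1%N)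
         + 1 / 2 * (Y 1%N - B 1%N + (d%:R - 3) * (B 2%N - B 1%N)) >= s.
Hypothesis h32 : a + 1 / 2 * (d%:R - 1) * B 2%N >= s.
Hypothesis h33 : B 2%N + 2 * Y 0%N + 2 * (d%:R - 2) * (B 2%N - B 1%N) >= s.
Hypothesis h34 : B 2%N + Y 0%N + (d%:R - 2) * (B 2%N - B 1%N) + (a - Y 0%N) >= s.
Hypothesis h35 : Y 0%N + (d%:R - 1) * B 1%N >= s.
Hypothesis h36 : forall i : nat, (2 <= i <= d - 2)%N ->
         a + (d%:R - i%:R) * (B i.+2 - B i.+1) + i%:R * (a - Y (i - 1)%N) >= s.
Hypothesis h37 : forall i : nat, (2 <= i <= d - 2)%N ->
         a + (d%:R - i%:R) * (B i.+2 - B i.+1)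
         + i%:R * (Y i.+1 - B i
                   + (d%:R - i%:R - 2) * (B i.+2 - B i.+1)) >= s.
Hypothesis h38 : forall i : nat, (2 <= i <= d - 2)%N ->
         Y i.+1 + (d%:R - i%:R - 2) * (B i.+2 - B i.+1)
         + (i%:R + 1) * (a - Y (i - 2)%N) >= s.
Hypothesis h39 : forall i : nat, (2 <= i <= d - 2)%N ->
         Y i.+1 + (d%:R - i%:R - 2) * (B i.+2 - B i.+1)
         + (i%:R + 1) * (Y i.+1 - B i
                         + (d%:R - i%:R - 2) * (B i.+2 - B i.+1)) >= s.
Hypothesis h40 : forall i : nat, (2 <= i <= d - 2)%N ->
         B i.+2 + (i%:R + 2) * (a - Y (i - 1)%N) >= s.
Hypothesis h41 : forall i : nat, (2 <= i <= d - 2)%N ->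
         B i.+2 + (i%:R + 2) * (Y i - B i
                                + (d%:R - i%:R - 2) * (B i.+2 - B i.+1)) >= s.

Let d6R : 6 <= d%:R :> R. Proof. by rewrite (ler_nat R 6). Qed.

(** * No undominated vertex survives once the degrees are at most 1, 2 and 3 *)

Section SmallDegrees.

Variable D : {set T}.
Hypothesis irrD : irreducible D.
Hypothesis mW : max_white D 1.
Hypothesis mY2 : max_yellow D 2.
Hypothesis mB3 : max_blue D 3.

Let B01 : B 0%N <= B 1%N. Proof. exact: B_mono. Qed.
Let B12 : B 1%N <= B 2%N. Proof. exact: B_mono. Qed.
Let B23 : B 2%N <= B 3%N. Proof. exact: B_mono. Qed.

Let B_diff12 : B 2%N - B 1%N <= B 1%N.
Proof. by have := B_concave 0%N; rewrite B0 subr0. Qed.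
Let B_diff23 : B 3%N - B 2%N <= B 2%N - B 1%N.
Proof. exact: (B_concave 1%N). Qed.

(* Lets two inequalities, one for white and one for yellow neighbours, be treated as
   one with the smaller of the two gains. *)
Lemma common_lower_bound (x1 x2 : R) :
  exists x, [/\ x <= x1, x <= x2 & x = x1 \/ x = x2].
Proof.
by have [l|/ltW l] := leP x1 x2; [exists x1 | exists x2]; split=> //; [left | right].
Qed.

Lemma white_yellow_separated : separated D.
Proof.
apply: (no_white_yellow irrD (slope_top mB3)) => //; first by rewrite subr_ge0.
by move: h19; lra.
Qed.

Lemma yellow_wyd_le1 : max_yellow D 1.
Proof.
apply: (no_yellow_sep irrD (slope_top mB3) _ white_yellow_separated mY2); first by rewrite subr_ge0.
by move: h20; lra.
Qed.

Lemma white_nbr u v : white D u -> v \in undom D -> e u v -> white D v.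
Proof.
by move=> uW; rewrite undomE => /orP[//|vY]; rewrite (white_yellow_separated uW vY).
Qed.

Lemma wyd_gt0P u : (0 < wyd D u)%N -> exists2 v, v \in undom D & e u v.
Proof.
rewrite card_gt0 => /set0Pn[v]; rewrite in_setI inE => /andP[uv vU].
by exists v.
Qed.

(** Otherwise [pair_out] applies to [v] and [p']; the two inequalities cover the white and the
    yellow gain of the other neighbours of [v]. *)
Lemma partner_in_nbrs k v p p' : max_blue D k.+1 -> v \in blue D -> white D p ->
  white D p' -> e v p -> e p p' ->
  2 * s <= B (wyd D v) + 2 * a + (B k.+1 - B k) * (2 * d%:R - 3)
    + ((wyd D v)%:R - 1) * (a - Y 1%N) ->
  2 * s <= B (wyd D v) + 2 * a + (B k.+1 - B k) * (2 * d%:R - 3)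
    + ((wyd D v)%:R - 1) * (Y 1%N - B 1%N + (B k.+1 - B k) * (d%:R - 2 - 1%:R)) ->
  e v p'.
Proof.
move=> mB vB pW p'W evp epp' hx1 hx2; apply/negPn/negP => nvp'.
set x1 := a - Y 1%N in hx1.
set x2 := Y 1%N - B 1%N + (B k.+1 - B k) * (d%:R - 2 - 1%:R) in hx2.
have [x [l1 l2 lx]] := common_lower_bound x1 x2.
have t0 : 0 <= B k.+1 - B k by rewrite subr_ge0 B_mono.
have : B (wyd D v) + 2 * a + (B k.+1 - B k) * (2 * d%:R - 3)
    + ((wyd D v)%:R - 1) * x < 2 * s.
  apply: (pair_out irrD (slope_top mB) t0 mW vB pW p'W evp epp' nvp') => u _ _ uC.
    by apply: le_trans l1 _; apply/white_gain/mW.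
  by apply: le_trans l2 _; exact: yellow_gain_blue (yellow_wyd_le1 uC) t0.
by case: lx => ->; lra.
Qed.

Lemma blue3_partner v p p' : v \in blue D -> wyd D v = 3%N -> white D p ->
  white D p' -> e v p -> e p p' -> e v p'.
Proof.
move=> vB wv pW p'W evp epp'; apply: (partner_in_nbrs mB3 vB pW p'W evp epp').
  by rewrite wv; move: h21; lra.
by rewrite wv; move: h22; lra.
Qed.

(** By [blue3_partner], [v] sees both ends of the edge and one more vertex [w]. If no other blue
    vertex with three undominated neighbours meets the edge, [pair_in] contradicts (23) or (24).
    Otherwise such a vertex [v'] also sees both ends: an equal third neighbour contradicts (25) or
    (26), a different one (21) or (22). *)
Lemma blue3_no_edge v p p' : v \in blue D -> wyd D v = 3%N -> white D p ->
  white D p' -> e v p -> e p p' -> False.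
Proof.
move=> vB wv pW p'W evp epp'; have evp' := blue3_partner vB wv pW p'W evp epp'.
have ep'p : e p' p by rewrite e_sym.
have [pU p'U] := (white_undom pW, white_undom p'W).
have pp' := adj_neq epp'.
have t0 : 0 <= B 3%N - B 2%N by rewrite subr_ge0.
(* [B 3] is the sum of three increments, the last being the smallest. This lets (21) and (22) be
   reused at the end, where [d - 3] stands in place of [d - 3/2] but a full [B 3] in place of half
   of it. *)
have b3 : 3 * (B 3%N - B 2%N) <= B 3%N by move: B_diff12 B_diff23; lra.
have third u : u \in blue D -> wyd D u = 3%N -> e u p -> e u p' -> exists w,
    [/\ w \in undom D, e u w, w != p, w != p' & forall x, x \in undom D -> e u x ->
     [|| x == p, x == p' | x == w]].
  move=> uB wu eup eup'; have := @card3_split (N u :&: undom D) p p' wu.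
  rewrite !in_setI pU p'U ![_ \in N u]inE eup eup' => /(_ isT isT pp')[w [wN wp wp' hw]].
  move: wN; rewrite in_setI inE => /andP[euw wU]; exists w; split => // x xU eux.
  by apply: hw; rewrite in_setI xU inE eux.
have [w [wU evw wp wp' hw]] := third v vB wv evp evp'.
(* A white partner of [w] would be seen by [v], hence be [p], [p'] or [w]. The first two already
   have each other as only undominated neighbour, and the last would be a loop. *)
have w0 : white D w -> wyd D w = 0%N.
  move=> wW; case E: (wyd D w) => [//|k]; exfalso.
  have [|x xU ewx] := @wyd_gt0P w; first by rewrite E.
  have xW := white_nbr wW xU ewx.
  have exw : e x w by rewrite e_sym.
  have /or3P[] := hw x xU (blue3_partner vB wv wW xW evw ewx) => /eqP xE.
  - rewrite xE in exw; have := wyd1_eq (mW pW) p'U wU epp' exw.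
    by move=> E'; rewrite E' eqxx in wp'.
  - rewrite xE in exw; have := wyd1_eq (mW p'W) pU wU ep'p exw.
    by move=> E'; rewrite E' eqxx in wp.
  - by move: ewx; rewrite xE e_irr.
have hwY : yellow D w -> Y 1%N - B 1%N <= Y (wyd D w) - B (wyd D w).
  by move=> /yellow_wyd_le1; exact: YB_le.
have hwb : yellow D w -> d%:R - 2 <= (bluedeg D w)%:R :> R.
  move=> wY; have := yellow_blue wY.
  have : (wyd D w)%:R <= 1 :> R by rewrite (ler_nat R _ 1) yellow_wyd_le1.
  lra.
case: (pickP (fun z => [&& z \in blue D, z != v, wyd D z == 3%N & e z p || e z p'])); last first.
  move=> hz; have {}hz z : z \in blue D -> z != v -> e z p || e z p' -> (wyd D z <= 2)%N.
    move=> zB zv ezp; have := hz z; rewrite zB zv ezp andbT /= => /negbT.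
    by have := mB3 zB; clear; lia.
  have H := pair_in irrD mW mB3 vB wv pW p'W evp evp' epp' evw wp wp' wU hz.
  move: (wU); rewrite undomE => /orP[] wC.
    have nY : ~ yellow D w by case/andP: wC => _ /eqP r0 /andP[_]; rewrite r0.
    have := H (a - Y 0%N); rewrite w0 // => h; move: h23.
    have : B 3%N + 2 * a + 2 * (B 2%N - B 1%N) * (d%:R - 2) + (a - Y 0%N) < 2 * s.
      by apply: h => // /nY.
    lra.
  have nW : ~ white D w by case/andP: wC => _ /eqP r1 /andP[_]; rewrite r1.
  have : B 3%N + 2 * a + 2 * (B 2%N - B 1%N) * (d%:R - 2)
    + (Y 1%N - B 1%N + (B 3%N - B 2%N) * (d%:R - 2 - 1%:R)) < 2 * s.
    by apply: H => [/nW //|y]; exact: (yellow_gain_blue y (yellow_wyd_le1 y) t0).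
  by move: h24; lra.
move=> v' /and4P[v'B v'v /eqP wv' ev'].
have [ev'p ev'p'] : e v' p /\ e v' p'.
  case/orP: ev' => h; first by split=> //; apply: (blue3_partner v'B wv' pW p'W h epp').
  by split=> //; apply: (blue3_partner v'B wv' p'W pW h ep'p).
have [w' [w'U ev'w' w'p w'p' hw']] := third v' v'B wv' ev'p ev'p'.
have vv' : v != v' by rewrite eq_sym.
have [E|ww'] := eqVneq w' w.
  rewrite E in ev'w'.
  have hz z : z \in blue D -> wyd D z = 3%N -> e z p = e z p'.
    move=> zB wz; apply/idP/idP => h; first exact: (blue3_partner zB wz pW p'W h epp').
    exact: (blue3_partner zB wz p'W pW h ep'p).
  have H := blue_pair_same irrD mW mB3 vB v'B vv' wv wv' pW p'W epp' evp evp' evw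
    ev'p ev'p' ev'w' wp wp' wU hz.
  move: (wU); rewrite undomE => /orP[] wC.
    have nY : ~ yellow D w by case/andP: wC => _ /eqP r0 /andP[_]; rewrite r0.
    have hb := white_blue wC; rewrite w0 // subr0 in hb.
    have : 2 * B 3%N + 2 * a + (B 3%N - B 1%N) * (d%:R - 3)
      + (a + (B 3%N - B 2%N) * (d%:R - 2)) < 2 * s.
      apply: H => [_|/nY //]; rewrite w0 // B0 subr0 lerD2l ler_wpM2l //; lra.
    by move: h25; lra.
  have nW : ~ white D w by case/andP: wC => _ /eqP r1 /andP[_]; rewrite r1.
  have : 2 * B 3%N + 2 * a + (B 3%N - B 1%N) * (d%:R - 3)
    + (Y 1%N - B 1%N + (B 3%N - B 2%N) * (d%:R - 4)) < 2 * s.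
    apply: H => [/nW //|y]; apply: lerD; first exact: hwY.
    by rewrite ler_wpM2l //; move: (hwb y); lra.
  by move: h26; lra.
have nv'w : ~~ e v' w.
  apply/negP => h; have := hw' w wU h.
  by rewrite (negbTE wp) (negbTE wp') eq_sym (negbTE ww').
have nvw' : ~~ e v w'.
  apply/negP => h; have := hw w' w'U h.
  by rewrite (negbTE w'p) (negbTE w'p') (negbTE ww').
set x1 := a - Y 1%N.
set x2 := Y 1%N - B 1%N + (B 3%N - B 2%N) * (d%:R - 2 - 1%:R).
have [x [l1 l2 lx]] := common_lower_bound x1 x2.
have : 2 * B 3%N + 2 * a + 2 * (B 3%N - B 2%N) * (d%:R - 3) + 2 * x < 2 * s.
  apply: (blue_pair_diff irrD mW (slope_top mB3) t0 vB v'B vv' wv wv' pW p'W epp'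
    evp evp' evw ev'p ev'p' ev'w' nv'w nvw' wU w'U) => u _ uC.
    by apply: le_trans l1 _; apply/white_gain/mW.
  by apply: le_trans l2 _; exact: yellow_gain_blue (yellow_wyd_le1 uC) t0.
by move: h21 h22; case: lx => ->; rewrite /x1 /x2; lra.
Qed.

(** By [blue3_no_edge], white neighbours of a blue vertex with three undominated neighbours have
    none themselves, which improves their gain to [a - Y 0]. *)
Lemma blue_wyd_le2 : max_blue D 2.
Proof.
move=> v vB; have := mB3 vB; rewrite leq_eqVlt => /predU1P[wv|//]; exfalso.
have t0 : 0 <= B 3%N - B 2%N by rewrite subr_ge0.
set x1 := a - Y 0%N.
set x2 := Y 1%N - B 1%N + (B 3%N - B 2%N) * (d%:R - 2 - 1%:R).
have [x [l1 l2 lx]] := common_lower_bound x1 x2.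
have : B (wyd D v) + (wyd D v)%:R * x < s.
  apply: (irreducible_blue_unif irrD vB (slope_top mB3) t0) => u evu uC.
    apply: le_trans l1 _; apply: white_gain; rewrite leqNgt; apply/negP.
    case/wyd_gt0P => u' u'U euu'.
    exact: (blue3_no_edge vB wv uC (white_nbr uC u'U euu') evu euu').
  by apply: le_trans l2 _; exact: yellow_gain_blue (yellow_wyd_le1 uC) t0.
by move: h27 h28; rewrite wv; case: lx => ->; rewrite /x1 /x2; lra.
Qed.

Let t2_ge0 : 0 <= B 2%N - B 1%N. Proof. by rewrite subr_ge0. Qed.

Lemma yellow_wyd_eq0 : max_yellow D 0.
Proof.
apply: (no_yellow_sep irrD (slope_top blue_wyd_le2) t2_ge0 white_yellow_separated yellow_wyd_le1).
by move: h29; rewrite B0; lra.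
Qed.

Lemma blue2_partner v p p' : v \in blue D -> wyd D v = 2%N -> white D p ->
  white D p' -> e v p -> e p p' -> e v p'.
Proof.
move=> vB wv pW p'W evp epp'; apply: (partner_in_nbrs blue_wyd_le2 vB pW p'W evp epp').
  by rewrite wv; move: h30; lra.
by rewrite wv; move: h31; lra.
Qed.

(** Both ends of a white edge are added, each charging [B 2 / 2] to its blue neighbours. A blue
    vertex with two undominated neighbours that meets the edge sees both ends by [blue2_partner] and
    loses all of [B 2]; one with a single undominated neighbour loses [B 1], at least [B 2 / 2] by
    concavity. Twice (32) then contradicts irreducibility. *)
Lemma white_wyd_eq0 : max_white D 0.
Proof.
move=> u uW; rewrite leqNgt; apply/negP => /wyd_gt0P[u' u'U euu'].
have u'W := white_nbr uW u'U euu'; have uU := white_undom uW.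
have eu'u : e u' u by rewrite e_sym.
have [uD u'D] := (undom_notin uU, undom_notin u'U).
have uu' := adj_neq euu'.
have dAD := pair_disjoint uD u'D.
have inlost z : z \in [set u; u'] -> z \in lost D [set u; u'].
  move=> zA; rewrite in_setD !inE; move: (zA); rewrite in_set2 => ->; rewrite orbT /=.
  by move: zA uU u'U; rewrite in_set2 !inE => /orP[] /eqP->.
pose c z := if (z == u) || (z == u') then B 2%N / 2 else 0.
have c0 z : 0 <= c z.
  by rewrite /c; case: ifP => // _; rewrite divr_ge0 // -B0 B_mono.
have hc z : z \in blue D -> z != u -> z != u' ->
    \sum_(x in N z :&: lost D [set u; u']) c x
    <= B (wyd D z) - B (wyd D z - #|N z :&: lost D [set u; u']|)%N.
  move=> zB _ _; set M := N z :&: _; have hM : (#|M| <= wyd D z)%N := lost_le _ _ _.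
  have wz := blue_wyd_le2 zB.
  case ez: (e z u || e z u'); last first.
    rewrite big1 ?subr_ge0 ?B_mono ?leq_subr // => x; rewrite in_setI inE => /andP[ezx _].
    by rewrite /c; case: ifP => // /orP[] /eqP xE; move: ez; rewrite -xE ezx ?orbT.
  have cM : \sum_(x in M) c x <= B 2%N / 2 * #|M|%:R.
    rewrite mulr_natr -sumr_const; apply: ler_sum => x _; rewrite /c; case: ifP => // _.
    by rewrite divr_ge0 // -B0 B_mono.
  move: (wz); rewrite leq_eqVlt => /predU1P[wz2|wz1].
    have [ezu ezu'] : e z u /\ e z u'.
      case/orP: ez => h; first by split=> //; exact: (blue2_partner zB wz2 uW u'W h euu').
      by split=> //; exact: (blue2_partner zB wz2 u'W uW h eu'u).
    have M2 : (2 <= #|M|)%N.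
      have <- : #|[set u; u']| = 2%N by rewrite cards2 uu'.
      apply: subset_leq_card; apply/subsetP => x xA; rewrite in_setI inlost // andbT.
      by move: xA; rewrite in_set2 inE => /orP[] /eqP->.
    have {M2} M2 : #|M| = 2%N by move: M2 hM wz2; clear; lia.
    by move: cM; rewrite wz2 M2 subnn B0; lra.
  have [M0|M1] : #|M| = 0%N \/ #|M| = 1%N by move: hM wz1; clear; lia.
    by move: cM; rewrite M0 mulr0 subn0 subrr.
  have w1 : wyd D z = 1%N by move: hM wz1; rewrite M1; clear; lia.
  by move: cM B_diff12; rewrite w1 M1 subnn B0 mulr1; lra.
have := @irreducible2 D u u' c (fun=> 0) [::] irrD uD u'D uu' c0 hc isT _ _.
rewrite big_nil addr0 (wt_white uW) (wt_white u'W).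
have -> : [set u; u'] :&: undom D = [set u; u'].
  by apply/setIidPl/subsetP => x; rewrite in_set2 => /orP[] /eqP->.
rewrite big_setU1 ?in_set1 //= big_set1 /c !eqxx orbT /=.
have out x : white D x -> d%:R - 1 <= (bluedeg_out D [set u; u'] x)%:R :> R.
  move=> xW; have := @bluedeg_pair D u u' x.
  have -> : u \in blue D = false by apply: contraTF uU; exact: blue_undom.
  have -> : u' \in blue D = false by apply: contraTF u'U; exact: blue_undom.
  rewrite /= addn0 => /bluedeg_cast hb; have := white_blue xW.
  have : (wyd D x)%:R <= 1 :> R by rewrite (ler_nat R _ 1) mW.
  lra.
have B2 : 0 <= B 2%N / 2 by rewrite divr_ge0 // -B0 B_mono.
have o1 : B 2%N / 2 * (d%:R - 1) <= B 2%N / 2 * (bluedeg_out D [set u; u'] u)%:R.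
  by rewrite ler_wpM2l // out.
have o2 : B 2%N / 2 * (d%:R - 1) <= B 2%N / 2 * (bluedeg_out D [set u; u'] u')%:R.
  by rewrite ler_wpM2l // out.
move=> h; have {}h : a + a + (B 2%N / 2 * (bluedeg_out D [set u; u'] u)%:R
  + B 2%N / 2 * (bluedeg_out D [set u; u'] u')%:R) < 2 * s by apply: h.
by move: h32; lra.
Qed.

(** Adding [v] gains from [q] and from its other undominated neighbour; (33) covers the case where
    that one is yellow, (34) the case where it is white. *)
Lemma blue2_no_yellow v q : v \in blue D -> wyd D v = 2%N -> yellow D q -> ~~ e v q.
Proof.
move=> vB wv qY; apply/negP => evq; have qU := yellow_undom qY.
have nyw u : yellow D u -> white D u = false.
  by case/andP => _ /eqP r1; rewrite /white r1 andbF.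
pose X u := if white D u then a - Y 0%N else Y 0%N + (B 2%N - B 1%N) * (d%:R - 2).
have : B (wyd D v) + \sum_(u in N v :&: undom D) X u < s.
  apply: (irreducible_blue irrD vB (slope_top blue_wyd_le2) t2_ge0) => u evu uC; rewrite /X.
    by rewrite uC; apply/white_gain/white_wyd_eq0.
  rewrite (nyw u uC); apply: le_trans (yellow_gain_blue uC (yellow_wyd_eq0 uC) t2_ge0).
  by rewrite B0; lra.
have qN : q \in N v :&: undom D by rewrite in_setI inE evq.
have /cards1P[r hr] : #|(N v :&: undom D) :\ q| == 1%N.
  by move: wv; rewrite /wyd (cardsD1 q) qN; clear; lia.
rewrite wv (big_setD1 q) //= hr big_set1 {1}/X (nyw q qY) /X.
by move: h33 h34; case: ifP => _; lra.
Qed.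

(** Every blue neighbour of a yellow [v] has [v] as its only undominated neighbour, by
    [blue2_no_yellow], and so can pay its full weight [B 1]; (35) applies. *)
Lemma no_yellow_left v : yellow D v = false.
Proof.
apply/negP => vY; have vU := yellow_undom vY; have vD := undom_notin vU.
have dAD : [disjoint [set v] & D] by rewrite disjoints1.
pose c u := if u == v then B 1%N else 0.
have c0 u : 0 <= c u by rewrite /c; case: ifP => // _; rewrite -B0.
have hc z : z \in blue D -> z \notin [set v] ->
    \sum_(u in N z :&: lost D [set v]) c u
    <= B (wyd D z) - B (wyd D z - #|N z :&: lost D [set v]|)%N.
  move=> zB _; case ezv: (e z v); last first.
    rewrite big1 ?subr_ge0 ?B_mono ?leq_subr // => u; rewrite in_setI inE => /andP[ezu _].
    by rewrite /c; case: eqP => // uv; rewrite uv ezv in ezu.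
  apply: (@charge_le D _ z c 0%N) => [|u _]; last first.
    by rewrite /c B0 subr0; case: ifP => // _; rewrite -B0.
  have := blue_wyd_le2 zB; rewrite leq_eqVlt => /predU1P[wz|//].
  by have := blue2_no_yellow zB wz vY; rewrite ezv.
have vA : [set v] :&: undom D = [set v] by apply/setIidPl; rewrite sub1set.
have : \sum_(u in [set v]) wt D u
  + \sum_(u in [set v] :&: undom D) c u * (bluedeg_out D [set v] u)%:R
  + \sum_(u <- [::] : seq T) (0 : R) < s.
  apply: le_lt_trans _ (irreducible1 irrD vD).
  exact: (gain (X := fun=> 0) dAD c0 hc (isT : uniq [::])).

rewrite vA !big_set1 big_nil addr0 (wt_yellow vY) /c eqxx.
have -> : bluedeg_out D [set v] v = bluedeg D v.
  rewrite /bluedeg_out /bluedeg; congr #|pred_of_set _|; congr setI; apply/setDidPl.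
  by rewrite disjoint_sym disjoints1; apply: contraL vU; exact: blue_undom.
have wv : wyd D v = 0%N by have := yellow_wyd_eq0 vY; rewrite leqn0 => /eqP.
have := yellow_blue vY; rewrite wv subr0 => hb.
have : B 1%N * (d%:R - 1) <= B 1%N * (bluedeg D v)%:R by rewrite ler_wpM2l // -B0.
by move: h35; lra.
Qed.

(** Only isolated white vertices remain, and all are added at once. Every blue vertex falls to
    [B 0], so it can pay [B 2 / 2] to each of its at most two white neighbours, and by (32) each
    added vertex accounts for at least [s]. *)
Lemma undom_empty : undom D = set0.
Proof.
apply/eqP/negPn/negP => U0; set A := undom D.
have UW u : u \in undom D -> white D u by rewrite undomE no_yellow_left orbF.
have dAD : [disjoint A & D].
  rewrite -setI_eq0; apply/eqP/setP => u; rewrite in_setI in_set0.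
  by apply/negbTE/negP => /andP[/undom_notin/negbTE->].
have B2_ge0 : 0 <= B 2%N / 2 by rewrite divr_ge0 // -B0 B_mono.
have U'0 : undom (D :|: A) = set0.
  apply/setP => u; rewrite in_set0; apply/negbTE/negP => uU'.
  have := undom_notin uU'.
  by rewrite in_setU negb_or (subsetP (undom_mono (subsetUl D A)) u uU') andbF.
have hc z : z \in blue D -> z \notin A -> \sum_(u in N z :&: lost D A) B 2%N / 2
    <= B (wyd D z) - B (wyd D z - #|N z :&: lost D A|)%N.
  move=> zB _; rewrite sumr_const -mulr_natr /lost U'0 setD0 -/(wyd D z) subnn B0 subr0.
  have := blue_wyd_le2 zB; case: (wyd D z) => [|[|[|k]]] // _; rewrite ?B0 ?mulr0 ?mulr1 //.
    by move: B_diff12; lra.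
  by lra.
have := irrD U0 dAD.
have : \sum_(u in A) wt D u
  + \sum_(u in A :&: undom D) B 2%N / 2 * (bluedeg_out D A u)%:R
  + \sum_(u <- [::] : seq T) (0 : R) <= Phi D - Phi (D :|: A).
  exact: (gain (X := fun=> 0) dAD (fun=> B2_ge0) hc (isT : uniq [::])).
rewrite big_nil addr0 setIid -big_split /= => h1 h2.
have : \sum_(u in A) s <= \sum_(u in A) (wt D u + B 2%N / 2 * (bluedeg_out D A u)%:R).
  apply: ler_sum => u uA; have uW := UW u uA; rewrite (wt_white uW).
  have -> : bluedeg_out D A u = bluedeg D u.
    rewrite /bluedeg_out /bluedeg; congr #|pred_of_set _|; congr setI; apply/setDidPl.
    rewrite -setI_eq0; apply/eqP/setP => w; rewrite in_setI in_set0.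
    by apply/negbTE/negP => /andP[/blue_undom/negbTE->].
  have wu : wyd D u = 0%N by have := white_wyd_eq0 uW; rewrite leqn0 => /eqP.
  have := white_blue uW; rewrite wu subr0 => hb.
  have : B 2%N / 2 * (d%:R - 1) <= B 2%N / 2 * (bluedeg D u)%:R.
    by rewrite ler_wpM2l //; lra.
  by move: h32; lra.
move=> h3; have := le_lt_trans (le_trans h3 h1) h2.
by rewrite sumr_const -[s *+ _]mulr_natl ltxx.
Qed.

End SmallDegrees.

(** * Descent to small degrees and completion to a 2-dominating set *)

Lemma large_degrees_excluded D : irreducible D -> max_white D d -> max_yellow D d.+1 ->
  [/\ max_white D 1, max_yellow D 2 & max_blue D 3].
Proof.
move=> iD mW mY.
have [k dk] : exists k, d = k.+3 by exists (d - 3)%N; move: d6; clear; lia.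
have [e1 e2 e3] : [/\ (d - 1 = k.+2)%N, (d - 2 = k.+1)%N & (d - 3 = k)%N].
  by rewrite dk !subSS !subn0.
have d0 : k.+3%:R = d%:R :> R by rewrite dk.
have d1 : k.+2%:R = d%:R - 1 :> R by rewrite -d0 -[k.+3%:R]natr1 addrK.
have dp : k.+4%:R = d%:R + 1 :> R by rewrite -d0 natr1.
(* No bound on blue degrees is known yet, so the first rounds, with (9) to (18), charge nothing to
   blue vertices. *)
have s0 := @slope0 D.
have mW2 : max_white D k.+2.
  rewrite dk in mW mY.
  apply: (no_white iD s0 _ mW mY) => //; rewrite d0; first by move: h9; rewrite e1; lra.
  by move: h10; rewrite dk d0; lra.
have mY3 : max_yellow D k.+3.
  rewrite dk in mY.
  apply: (no_yellow iD s0 _ mW2 mY) => //; rewrite dp.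
    by move: h11; rewrite e2 [in Y _]dk; lra.
  by move: h12; rewrite [in Y _]dk [in B _]dk; lra.
have mW1 : max_white D k.+1.
  apply: (no_white iD s0 _ mW2 mY3) => //; rewrite d1.
    by move: h13; rewrite e2; lra.
  by move: h14; rewrite e1 [in Y _]dk; lra.
have mY2 : max_yellow D k.+2.
  apply: (no_yellow iD s0 _ mW1 mY3) => //; rewrite d0.
    by move: h15; rewrite e3 [in Y _]dk; lra.
  by move: h16; rewrite e1 [in Y _]dk; lra.
have mB3 : max_blue D k.+3.
  apply: (no_blue iD s0 _ mW1 mY2) => //.
  - by rewrite mul0r addr0 subr_ge0.
  - by rewrite dp; move: h17; rewrite e2 [in B _]dk; lra.
  - by rewrite dp; move: h18; rewrite e1 [in B _]dk; lra.
(* Downward induction on [m], with [n] counting the completed rounds. One round uses (36) to (41) at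
   [i = m + 2], lowering the white, yellow and blue bounds in this order, with the charge allowed by
   the previous blue bound. *)
have {mW mW2 mY mY3} : forall n m, (m + n = k)%N ->
    [/\ max_white D m.+1, max_yellow D m.+2 & max_blue D m.+3].
  elim=> [|n IH] m mn; first by rewrite addn0 in mn; rewrite mn.
  have {IH}[//|W' Y' B'] := IH m.+1; first by rewrite addSnnS.
  have hi : (2 <= m.+2 <= d - 2)%N by rewrite e2; move: mn; clear; lia.
  have hmd : m%:R + 4 <= d%:R :> R.
    by rewrite -natrD (ler_nat R) dk; move: mn; clear; lia.
  set t := B m.+4 - B m.+3.
  have t0 : 0 <= t by rewrite subr_ge0 B_mono.
  have ht : slope D t := slope_top B'.
  have m2 : m.+2%:R = m%:R + 2 :> R by rewrite -addn2 natrD.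
  have m3 : m.+3%:R = m%:R + 3 :> R by rewrite -addn3 natrD.
  have m4 : m.+4%:R = m%:R + 4 :> R by rewrite -addn4 natrD.
  have W1 : max_white D m.+1.
    apply: (no_white iD ht t0 W' Y').
      by move: (h36 hi); rewrite subn1 -/t /= m2; lra.
    by move: (h37 hi); rewrite -/t m2 m3; lra.
  have Y1 : max_yellow D m.+2.
    apply: (no_yellow iD ht t0 W1 Y').
      by move: (h38 hi); rewrite -/t subn2 /= m2 m3; lra.
    by move: (h39 hi); rewrite -/t m2 m3; lra.
  split=> //; apply: (no_blue iD ht t0 W1 Y1).
  - by rewrite addr_ge0 ?subr_ge0 // mulr_ge0 // m2; lra.
  - by move: (h40 hi); rewrite subn1 /= m2 m4; lra.
  - by move: (h41 hi); rewrite -/t m2 m4; lra.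
by move=> /(_ k 0%N (add0n _)).
Qed.

Lemma max_white_mono D D' i : D \subset D' -> max_white D i -> max_white D' i.
Proof.
move=> sD mW u /andP[uD' r0]; apply: leq_trans (wyd_mono u sD) (mW u _).
by rewrite /white (contra (subsetP sD u) uD') -leqn0 (leq_trans (red_mono u sD)) // leqn0.
Qed.

(** A vertex yellow for [D'] may have been white for [D], so the white bound enters too. *)
Lemma max_yellow_mono D D' i : D \subset D' -> max_white D i -> max_yellow D i.+1 ->
  max_yellow D' i.+1.
Proof.
move=> sD mW mY u uY; apply: leq_trans (wyd_mono u sD) _.
have := subsetP (undom_mono sD) u (yellow_undom uY).
by rewrite undomE => /orP[/mW/leqW|/mY].
Qed.

(** Induction on the size of the complement: a set [A] that pays [s] per vertex is added as long as
    there is one; without one, [D] is irreducible and has no undominated vertex. *)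
Lemma extend_to_dominating D : max_white D d -> max_yellow D d.+1 ->
  exists2 D', undom D' = set0 & #|D'|%:R * s + Phi D' <= #|D|%:R * s + Phi D.
Proof.
have [n] := ubnP #|~: D|; elim: n D => // n IH D; rewrite ltnS => hn mW mY.
pose good A := [&& A != set0, [disjoint A & D]
  & #|A|%:R * s <= Phi D - Phi (D :|: A)].
have [A /and3P[A0 dAD hA]|noA] := pickP good; last first.
  have iD : irreducible D.
    by move=> A A0 dAD; rewrite ltNge; have := noA A; rewrite /good A0 dAD => /negbT.
  have [W1 Y2 B3] := large_degrees_excluded iD mW mY.
  by exists D => //; exact: undom_empty iD W1 Y2 B3.
have sD : D \subset D :|: A by apply: subsetUl.
have DA0 : D :&: A = set0 by rewrite setIC; apply/eqP; rewrite setI_eq0.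
have [|D' U0 hD'] := IH (D :|: A) _ (max_white_mono sD mW) (max_yellow_mono sD mW mY).
  apply: leq_trans hn; have /set0Pn[x xA] := A0.
  apply: proper_card; rewrite properE setCS sD /=; apply/subsetPn; exists x.
    by rewrite inE; apply: contraTN xA => xD; rewrite (disjointFl dAD xD).
  by rewrite !inE xA orbT.
exists D' => //; apply: le_trans hD' _.
by rewrite cardsU DA0 cards0 subn0 natrD; lra.
Qed.

End Inequalities.

End Potential.

(** * The greedy stage *)

Section LargeDegrees.

Variables (R : realFieldType) (T : finType) (e : rel T).
Hypotheses (e_sym : symmetric e) (e_irr : irreflexive e).
Variables (a s : R).
Hypothesis a_lt_s : a < s.

Implicit Types (D : {set T}) (N : nat).

(* A yellow vertex with k undominated neighbours had at least k+1 of them when its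
   neighbour was put into D, so this happened at level k+1 or higher. *)
Definition level_yellow N k : R := a - (s - a) / (maxn N k.+1)%:R.
(** The second neighbour in [D] used up one more undominated neighbour, hence [k.+2] for the first
    loss; the second loss happened at level [N] or higher and is at most [(s - a) / N]. *)
Definition level_blue N k : R :=
  a - (s - a) / (maxn N k.+2)%:R - (s - a) / N%:R.

Lemma share_le m n : (0 < m <= n)%N -> (s - a) / n%:R <= (s - a) / m%:R.
Proof.
case/andP => m0 mn; apply: ler_wpM2l; first by rewrite subr_ge0 ltW.
by rewrite lef_pV2 ?posrE ?ltr0n ?ler_nat // (leq_trans m0).
Qed.

Lemma share_ge0 n : 0 <= (s - a) / n%:R.
Proof. by rewrite divr_ge0 // subr_ge0 ltW. Qed.

Lemma level_yellow_le_a N k : level_yellow N k <= a.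
Proof. by rewrite gerBl share_ge0. Qed.

Lemma level_yellow_mono N : {homo level_yellow N : i j / (i <= j)%N >-> i <= j}.
Proof. by move=> i j ij; rewrite lerD2l lerN2 share_le //; move: ij; clear; lia. Qed.

Lemma level_blue_mono N : {homo level_blue N : i j / (i <= j)%N >-> i <= j}.
Proof.
by move=> i j ij; rewrite lerD2r lerD2l lerN2 share_le //; move: ij; clear; lia.
Qed.

Lemma level_blue_le_yellow N k : (0 < N)%N -> level_blue N k <= level_yellow N k.
Proof.
move=> N0; rewrite /level_blue /level_yellow.
have : (s - a) / (maxn N k.+1)%:R <= (s - a) / N%:R.
  by rewrite share_le // N0 leq_maxl.
by have := share_ge0 (maxn N k.+2); lra.
Qed.

Notation level_Phi N := (Phi e a (level_yellow N) (level_blue N)).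

(** Each undominated neighbour loses at least [(s - a) / N]. A white [v] contributes [a] and [N]
    such shares, in total [s]; a yellow one has itself lost at most one share but has [N.+1]
    neighbours. No charge to blue vertices is used. *)
Lemma level_pick N D v : (0 < N)%N -> max_white e D N -> max_yellow e D N.+1 ->
  white e D v && (wyd e D v == N) || yellow e D v && (wyd e D v == N.+1) ->
  s <= level_Phi N D - level_Phi N (D :|: [set v]).
Proof.
move=> N0 mW mY hv.
have vU : v \in undom e D by rewrite undomE; case/orP: hv => /andP[-> _]; rewrite ?orbT.
have vD := undom_notin vU.
have B_le_Y k := level_blue_le_yellow k N0.
have s0 := slope0 (e := e) (@level_blue_mono N) (D := D).
have := gain1 e_sym (level_yellow_le_a N) (@level_yellow_mono N)
  (@level_blue_mono N) B_le_Y e_irr (X := fun=> (s - a) / N%:R) vD s0 (lexx _).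
rewrite vU mul0r addr0 sumr_const -[_ *+ #|_|]mulr_natl -/(wyd e D v) => h.
apply: le_trans (h _ _) => {h}.
- have N1 : N%:R * ((s - a) / N%:R) = s - a.
    by rewrite mulrC divfK // pnatr_eq0 -lt0n.
  case/orP: hv => /andP[vC /eqP->].
    by rewrite (wt_white _ _ _ vC) N1; lra.
  rewrite (wt_yellow _ _ _ vC) -natr1 mulrDl N1 mul1r /level_yellow.
  have : (s - a) / (maxn N (wyd e D v).+1)%:R <= (s - a) / N%:R.
    by rewrite share_le // N0 leq_maxl.
  by lra.
- move=> u evu uW; rewrite subn1 /level_yellow subKr.
  have u0 : (0 < wyd e D u)%N by apply: (wyd_gt0 vU); rewrite e_sym.
  by rewrite share_le // prednK // (maxn_idPl (mW u uW)) leqnn N0.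
move=> u evu uY; rewrite subn1 mul0r addr0 /level_yellow /level_blue.
have u0 : (0 < wyd e D u)%N by apply: (wyd_gt0 vU); rewrite e_sym.
by rewrite prednK //; lra.
Qed.

Lemma level_down N D : (0 < N)%N -> max_white e D N -> max_yellow e D N.+1 ->
  exists D', [/\ max_white e D' N.-1, max_yellow e D' N
    & #|D'|%:R * s + level_Phi N D' <= #|D|%:R * s + level_Phi N D].
Proof.
move=> N0; have [n] := ubnP #|~: D|; elim: n D => // n IH D; rewrite ltnS => hn mW mY.
pose top v := white e D v && (wyd e D v == N) || yellow e D v && (wyd e D v == N.+1).
have [v hv|htop] := pickP top; last first.
  exists D; split=> // u uC.
    have /negbT := htop u; rewrite /top uC /= negb_or => /andP[h _].
    by move: h (mW u uC) N0; clear; lia.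
  have /negbT := htop u; rewrite /top uC /= negb_or => /andP[_ h].
  by move: h (mY u uC); clear; lia.
have vD : v \notin D by case/orP: hv => /andP[/andP[]].
have sD : D \subset D :|: [set v] by apply: subsetUl.
have [|D' [W' Y' hD']] := IH (D :|: [set v]) _ (max_white_mono sD mW)
    (max_yellow_mono sD mW mY).
  apply: leq_trans hn; apply: proper_card; rewrite properE setCS sD /=.
  by apply/subsetPn; exists v; rewrite !inE ?eqxx ?orbT.
exists D'; split=> //; apply: le_trans hD' _.
have -> : #|D :|: [set v]| = #|D|.+1 by rewrite setUC cardsU1 vD.
by have := level_pick N0 mW mY hv; rewrite -natr1; lra.
Qed.

Lemma Phi_le (Y1 Y2 B1 B2 : nat -> R) D : (forall k, Y1 k <= Y2 k) ->
  (forall k, B1 k <= B2 k) -> Phi e a Y1 B1 D <= Phi e a Y2 B2 D.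
Proof.
move=> hY hB; apply: ler_sum => v _; rewrite /wt.
by case: ifP => // _; case: (red e D v) => [|[|]].
Qed.

(** Passing to the weights of the next lower level never raises the total, so the stages can be
    chained. *)
Lemma level_Phi_succ N D : (0 < N)%N -> level_Phi N D <= level_Phi N.+1 D.
Proof.
move=> N0; apply: Phi_le => k; rewrite /level_yellow /level_blue.
  by rewrite lerD2l lerN2 share_le //; move: N0; clear; lia.
by apply: lerD; rewrite ?lerD2l lerN2 share_le //; move: N0; clear; lia.
Qed.

Lemma eliminate_large d : exists D, [/\ max_white e D d, max_yellow e D d.+1
  & #|D|%:R * s + level_Phi d.+1 D <= #|T|%:R * a].
Proof.
have start N : level_Phi N set0 = #|T|%:R * a.
  rewrite mulr_natl -sumr_const; apply: eq_bigr => v _.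
  by rewrite /wt inE /red setI0 cards0.
have descend n D : max_white e D (d.+1 + n) -> max_yellow e D (d.+1 + n).+1 ->
  exists D', [/\ max_white e D' d, max_yellow e D' d.+1
    & #|D'|%:R * s + level_Phi d.+1 D' <= #|D|%:R * s + level_Phi (d.+1 + n) D].
  elim: n D => [|n IH] D; first by rewrite addn0; exact: level_down.
  rewrite addnS => mW mY; have [//|D1 [W1 Y1 h1]] := level_down _ mW mY.
  have [D' [W' Y' h']] := IH D1 W1 Y1; exists D'; split=> //.
  apply: le_trans h' (le_trans _ h1).
  by rewrite lerD2l level_Phi_succ.
(* The starting level is so high that its degree bounds hold trivially. *)
have big u : (wyd e set0 u <= d.+1 + #|T|)%N.
  by apply: leq_trans (max_card _) _; rewrite leq_addl.
have [||D [W1 Y1 h]] := descend #|T| set0; first by move=> u _; exact: big.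
  by move=> u _; exact: leqW.
by exists D; split=> //; move: h; rewrite start cards0 mul0r add0r.
Qed.

End LargeDegrees.

(** * Assembling the bound on the 2-domination number *)

Lemma min_degree_le (T : finType) (e : rel T) v : (min_degree e <= degree e v)%N.
Proof.
rewrite /min_degree; have : v \in index_enum T by rewrite mem_index_enum.
elim: (index_enum T) => // u r IH; rewrite in_cons big_cons geq_min.
by case/predU1P => [->|/IH->]; rewrite ?leqnn ?orbT.
Qed.

Lemma gamma2_le (T : finType) (e : rel T) D : undom e D = set0 -> (gamma2 e <= #|D|)%N.
Proof.
move=> U0; rewrite /gamma2; case: arg_minnP => [|D' _]; last apply.
  by apply/forall_inP => v; rewrite !inE.
apply/forall_inP => v; rewrite in_setC => vD.
have : v \notin undom e D by rewrite U0 inE.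
by rewrite inE vD /= -ltnNge.
Qed.

Theorem theorem1 (R : realType) (T : finType) (e : rel T)
  (e_sym : symmetric e) (e_irr : irreflexive e)
  (d : nat) (d_ge6 : (6 <= d)%N) (min_deg : min_degree e = d)
  (a s : R) (y b : nat -> R)
  (a_ge0 : 0 <= a)
  (y_ge0 : forall i : nat, (i <= d.+1)%N -> 0 <= y i)
  (b_ge0 : forall i : nat, (i <= d.+1)%N -> 0 <= b i)
  (s_gt0 : 0 < s)
  (h1 : [/\ s > a, a >= y d.+1,
            forall i : nat, (i <= d)%N -> y i.+1 >= y i,
            y 0%N >= b 0%N & b 0%N = 0])
  (h2 : [/\ 0 <= b d.+1 - b d,
            forall i : nat, (2 <= i <= d)%N -> b i.+1 - b i <= b i - b i.-1
          & b 2%N - b 1%N <= b 1%N])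
  (h3 : [/\ 0 <= y d.+1 - b d.+1,
            forall i : nat, (1 <= i <= d)%N -> y i.+1 - b i.+1 <= y i - b i
          & y 1%N - b 1%N <= y 0%N])
  (h4 : y d.+1 <= a - (s - a) / (d%:R + 2))
  (h5 : y d <= a - (s - a) / (d%:R + 1))
  (h6 : b d.+1 <= a - (s - a) / (d%:R + 3) - (s - a) / (d%:R + 1))
  (h7 : b d <= a - (s - a) / (d%:R + 2) - (s - a) / (d%:R + 1))
  (h8 : b (d - 1)%N <= a - 2 * ((s - a) / (d%:R + 1)))
  (h9 : a + d%:R * (a - y (d - 1)%N) >= s)
  (h10 : a + d%:R * (y d.+1 - b d) >= s)
  (h11 : y d.+1 + (d%:R + 1) * (a - y (d - 2)%N) >= s)
  (h12 : y d.+1 + (d%:R + 1) * (y d.+1 - b d) >= s)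
  (h13 : a + (d%:R - 1) * (a - y (d - 2)%N) >= s)
  (h14 : a + (d%:R - 1) * (y d - b (d - 1)%N) >= s)
  (h15 : y d + d%:R * (a - y (d - 3)%N) >= s)
  (h16 : y d + d%:R * (y d - b (d - 1)%N) >= s)
  (h17 : b d.+1 + (d%:R + 1) * (a - y (d - 2)%N) >= s)
  (h18 : b d.+1 + (d%:R + 1) * (y (d - 1)%N - b (d - 1)%N) >= s)
  (h19 : a + (d%:R - 1) * (b 3%N - b 2%N) + (y 2%N - b 1%N)
         + (d%:R - 3) * (b 3%N - b 2%N) >= s)
  (h20 : y 2%N + (d%:R - 3) * (b 3%N - b 2%N)
         + 2 * (y 2%N - b 1%N + (d%:R - 3) * (b 3%N - b 2%N)) >= s)
  (h21 : a + 1 / 2 * b 3%N + (d%:R - 3 / 2) * (b 3%N - b 2%N)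
         + (a - y 1%N) >= s)
  (h22 : a + 1 / 2 * b 3%N + (d%:R - 3 / 2) * (b 3%N - b 2%N)
         + (y 1%N - b 1%N + (d%:R - 3) * (b 3%N - b 2%N)) >= s)
  (h23 : 3 / 2 * a + 1 / 2 * b 3%N - 1 / 2 * y 0%N
         + (d%:R - 2) * (b 2%N - b 1%N) >= s)
  (h24 : a + 1 / 2 * b 3%N + 1 / 2 * y 1%N - 1 / 2 * b 1%N
         + (d%:R - 2) * (b 2%N - b 1%N)
         + 1 / 2 * (d%:R - 3) * (b 3%N - b 2%N) >= s)
  (h25 : 3 / 2 * a + b 3%N + 1 / 2 * (d%:R - 3) * (b 3%N - b 1%N)
         + 1 / 2 * (d%:R - 2) * (b 3%N - b 2%N) >= s)
  (h26 : a + b 3%N + 1 / 2 * y 1%N - 1 / 2 * b 1%N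
         + 1 / 2 * (d%:R - 3) * (b 3%N - b 1%N)
         + 1 / 2 * (d%:R - 4) * (b 3%N - b 2%N) >= s)
  (h27 : b 3%N + 3 * (a - y 0%N) >= s)
  (h28 : b 3%N + 3 * (y 1%N - b 1%N + (d%:R - 3) * (b 3%N - b 2%N)) >= s)
  (h29 : 2 * y 1%N + 2 * (d%:R - 2) * (b 2%N - b 1%N) >= s)
  (h30 : a + 1 / 2 * b 2%N + (d%:R - 3 / 2) * (b 2%N - b 1%N)
         + 1 / 2 * (a - y 1%N) >= s)
  (h31 : a + 1 / 2 * b 2%N + (d%:R - 3 / 2) * (b 2%N - b 1%N)
         + 1 / 2 * (y 1%N - b 1%N + (d%:R - 3) * (b 2%N - b 1%N)) >= s)
  (h32 : a + 1 / 2 * (d%:R - 1) * b 2%N >= s)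
  (h33 : b 2%N + 2 * y 0%N + 2 * (d%:R - 2) * (b 2%N - b 1%N) >= s)
  (h34 : b 2%N + y 0%N + (d%:R - 2) * (b 2%N - b 1%N) + (a - y 0%N) >= s)
  (h35 : y 0%N + (d%:R - 1) * b 1%N >= s)
  (h36 : forall i : nat, (2 <= i <= d - 2)%N ->
         a + (d%:R - i%:R) * (b i.+2 - b i.+1) + i%:R * (a - y (i - 1)%N) >= s)
  (h37 : forall i : nat, (2 <= i <= d - 2)%N ->
         a + (d%:R - i%:R) * (b i.+2 - b i.+1)
         + i%:R * (y i.+1 - b i
                   + (d%:R - i%:R - 2) * (b i.+2 - b i.+1)) >= s)
  (h38 : forall i : nat, (2 <= i <= d - 2)%N ->
         y i.+1 + (d%:R - i%:R - 2) * (b i.+2 - b i.+1)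
         + (i%:R + 1) * (a - y (i - 2)%N) >= s)
  (h39 : forall i : nat, (2 <= i <= d - 2)%N ->
         y i.+1 + (d%:R - i%:R - 2) * (b i.+2 - b i.+1)
         + (i%:R + 1) * (y i.+1 - b i
                         + (d%:R - i%:R - 2) * (b i.+2 - b i.+1)) >= s)
  (h40 : forall i : nat, (2 <= i <= d - 2)%N ->
         b i.+2 + (i%:R + 2) * (a - y (i - 1)%N) >= s)
  (h41 : forall i : nat, (2 <= i <= d - 2)%N ->
         b i.+2 + (i%:R + 2) * (y i - b i
                                + (d%:R - i%:R - 2) * (b i.+2 - b i.+1)) >= s) :
  (gamma2 e)%:R <= a / s * #|T|%:R.
Proof.
have [s_gt_a y_le_a y_step _ b0] := h1.
have [b_last b_concave b_first] := h2; have [yb_last yb_step yb_first] := h3.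
(* All degrees above d+1 get the same weight as d+1. *)
pose Y k := y (minn k d.+1); pose B k := b (minn k d.+1).
have lo k : (k <= d.+1)%N -> (Y k = y k) * (B k = b k).
  by move=> hk; rewrite /Y /B (minn_idPl hk).
have hi k : (d.+1 <= k)%N -> (Y k = y d.+1) * (B k = b d.+1).
  by move=> hk; rewrite /Y /B (minn_idPr hk).
(* Increments of [B] and gaps [Y k - B k] are nonincreasing in [k], so their nonnegativity spreads
   downwards from the constant tail. *)
have up k (P : nat -> Prop) : (forall i, (d.+1 <= i)%N -> P i) ->
    (forall i, P i.+1 -> P i) -> P k.
  move=> P_hi P_down; have: P (k + d.+1)%N by apply: P_hi; rewrite leq_addl.
  by elim: (d.+1) => [|n IH]; rewrite ?addn0 // addnS => /P_down.
have B_concave k : B k.+2 - B k.+1 <= B k.+1 - B k.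
  have [hk|hk] := leqP k d; last first.
    by rewrite (hi _ (leqW (leqW hk))) (hi _ (leqW hk)) (hi _ hk).
  (* At [k = d] the left side is 0 and the last increment of [b] is nonnegative; [k = 0] is the
     separate inequality [b_first], read with [b 0 = 0]. *)
  move: hk; rewrite leq_eqVlt => /predU1P[->|k_lt_d].
    by rewrite (hi d.+2) // !lo // subrr.
  have [l0 l1 l2] : [/\ k <= d.+1, k.+1 <= d.+1 & k.+2 <= d.+1]%N.
    by split; move: k_lt_d; clear; lia.
  rewrite !(lo _ l0, lo _ l1, lo _ l2).
  case: k k_lt_d {l0 l1 l2} => [|k] hk; first by rewrite b0 subr0.
  by apply: (b_concave k.+2); rewrite /= hk.
have YB_mono k : Y k.+1 - B k.+1 <= Y k - B k.
  have [hk|hk] := leqP k d; last by rewrite !(hi _ hk) !(hi _ (leqW hk)).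
  rewrite !(lo k.+1 hk) !(lo k (leqW hk)); case: k hk => [|k] hk; first by rewrite b0 subr0.
  exact: (yb_step k.+1).
have B_step k : 0 <= B k.+1 - B k.
  apply: (up k (fun k => 0 <= B k.+1 - B k)) => i; last by move/le_trans; apply.
  by move=> hk; rewrite (hi _ hk) (hi _ (leqW hk)) subrr.
have B_le_Y k : B k <= Y k.
  rewrite -subr_ge0; apply: (up k (fun k => 0 <= Y k - B k)) => i.
    by move=> hk; rewrite !(hi _ hk).
  by move/le_trans; apply.
have Y_mono : {homo Y : i j / (i <= j)%N >-> i <= j}.
  apply: homo_leq => [x|x z t|k]; [exact: lexx | exact: le_trans |].
  have [hk|hk] := leqP k d; last by rewrite (hi _ hk) (hi _ (leqW hk)).
  by rewrite (lo k.+1 hk) (lo k (leqW hk)) y_step.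
have B_mono : {homo B : i j / (i <= j)%N >-> i <= j}.
  apply: homo_leq => [x|x z t|k]; [exact: lexx | exact: le_trans |].
  by rewrite -subr_ge0.
have Y_le_a k : Y k <= a.
  apply: le_trans (Y_mono k (maxn k d.+1) (leq_maxl _ _)) _.
  by rewrite hi ?leq_maxr.
have deg_ge v : (d <= degree e v)%N by rewrite -min_deg min_degree_le.
have small i : (i <= 3)%N -> (i <= d.+1)%N by move: d_ge6; clear; lia.
have dB : (d <= d.+1)%N by [].
have d1B : (d - 1 <= d.+1)%N by clear; lia.
have d2B : (d - 2 <= d.+1)%N by clear; lia.
have d3B : (d - 3 <= d.+1)%N by clear; lia.
have E := (lo 0%N (small 0%N isT), lo 1%N (small 1%N isT), lo 2%N (small 2%N isT),
  lo 3%N (small 3%N isT), lo _ (leqnn d.+1), lo _ dB, lo _ d1B, lo _ d2B, lo _ d3B).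
have B0 : B 0%N = 0 by rewrite E.
have fits i (r : (2 <= i <= d - 2)%N) j : (j <= i.+2)%N -> (j <= d.+1)%N.
  by move: r; clear; lia.
(* Restates (9) to (35) for the extended sequences. *)
let cap h := rewrite -!E in h in cap h9; cap h10; cap h11; cap h12; cap h13; cap h14;
  cap h15; cap h16; cap h17; cap h18; cap h19; cap h20; cap h21; cap h22; cap h23;
  cap h24; cap h25; cap h26; cap h27; cap h28; cap h29; cap h30; cap h31; cap h32;
  cap h33; cap h34; cap h35.
have G i (r : (2 <= i <= d - 2)%N) := (lo i.+2 (fits i r i.+2 (leqnn _)),
  lo i.+1 (fits i r i.+1 (leqnSn _)), lo i (fits i r i (leqW (leqnSn _))),
  lo (i - 1)%N (fits i r _ (leq_trans (leq_subr 1 i) (leqW (leqnSn _)))),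
  lo (i - 2)%N (fits i r _ (leq_trans (leq_subr 2 i) (leqW (leqnSn _))))).
have [D0 [W0 Y0 hD0]] := eliminate_large e_sym e_irr s_gt_a d.
have [D U0 hD] : exists2 D, undom e D = set0 &
    #|D|%:R * s + Phi e a Y B D <= #|D0|%:R * s + Phi e a Y B D0.
  apply: (extend_to_dominating e_sym Y_le_a Y_mono B_mono B_le_Y e_irr deg_ge
    B_concave YB_mono B0 d_ge6 h9 h10 h11 h12 h13 h14 h15 h16 h17 h18 h19 h20 h21 h22 h23
    h24 h25 h26 h27 h28 h29 h30 h31 h32 h33 h34 h35 _ _ _ _ _ _ W0 Y0) => i r;
    rewrite !(G i r).
  - exact: h36.
  - exact: h37.
  - exact: h38.
  - exact: h39.
  - exact: h40.
  - exact: h41.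
have dn1 : d.+1%:R = d%:R + 1 :> R by rewrite natr1.
have dn2 : d.+2%:R = d%:R + 2 :> R by rewrite -addn2 natrD.
have dn3 : d.+3%:R = d%:R + 3 :> R by rewrite -addn3 natrD.
(* Change of weights between the stages. Yellow: (5) for [k] up to [d], (4) beyond. Blue: (8) below
   [d], (7) at [d], (6) beyond; the maxima in the level weights are [d + 1] up to the threshold and
   larger after it. *)
have hD1 : Phi e a Y B D0 <= Phi e a (level_yellow a s d.+1) (level_blue a s d.+1) D0.
  apply: Phi_le => k; rewrite /level_yellow /level_blue.
    have [hk|hk] := leqP k d.
      rewrite (maxn_idPl _) // dn1; apply: le_trans (Y_mono _ _ hk) _.
      by rewrite (lo d).
    rewrite (hi _ hk); apply: le_trans h4 _; rewrite -dn2 lerD2l lerN2.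
    by apply: (share_le s_gt_a); rewrite leq_max orbC /= ltnS hk.
  have [hk|hk|->] := ltngtP k d.
  - rewrite (maxn_idPl _) // dn1; apply: le_trans (B_mono k (d - 1)%N _) _.
      by move: hk; clear; lia.
    by rewrite (lo _ d1B); move: h8; lra.
  - rewrite (hi _ hk); apply: le_trans h6 _; rewrite -dn3 -dn1 lerD2r lerD2l lerN2.
    by apply: (share_le s_gt_a); rewrite leq_max orbC /= !ltnS hk.
  - by rewrite (lo d) // (maxn_idPr _) // dn2 dn1.
have Phi0 : 0 <= Phi e a Y B D.
  apply: sumr_ge0 => v _; rewrite /wt; case: ifP => // _.
  have B_ge0 k : 0 <= B k by rewrite -B0 B_mono.
  by case: (red e D v) => [|[|r]] //; apply: le_trans (B_le_Y _).
rewrite mulrAC ler_pdivlMr // [a * _]mulrC.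
apply: le_trans (_ : #|D|%:R * s <= _).
  by apply: ler_wpM2r; [exact: ltW | rewrite ler_nat gamma2_le].
by move: Phi0 hD hD0 hD1; lra.
Qed.
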